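(* Let $0<p<2$ and let $(\mathbf{B},\|\cdot\|)$ be a real separable Banach space. Let $\{X,X_n;\,n\ge1\}$ be a sequence of i.i.d. $\mathbf{B}$-valued random variables and set $S_n=\sum_{i=1}^n X_i$, $n\ge1$. Suppose that $$\frac{S_n}{n^{1/p}}\to 0 \quad\text{in probability}.$$ Then for all $s>0$, $$\limsup_{n\to\infty}\frac{1}{\log n}\log\mathbb{P}\left(\|S_n\|>s n^{1/p}\right)=-\frac{\bar\beta-p}{p}$$ and $$\liminf_{n\to\infty}\frac{1}{\log n}\log\mathbb{P}\left(\|S_n\|>s n^{1/p}\right)=-\frac{\underline\beta-p}{p}.$$ Consequently, under the same hypothesis, for all $s>0$ and any $\hat\beta\in[0,\infty]$, $\lim_{n\to\infty}\frac{1}{\log n}\log\mathbb{P}(\|S_n\|>sn^{1/p})=-(\hat\beta-p)/p$ if and only if $\bar\beta=\underline\beta=\hat\beta$.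
   Context: For a $\mathbf{B}$-valued random variable $X$ define $$\bar\beta=-\limsup_{t\to\infty}\frac1t\log\mathbb{P}(\log\|X\|>t)\in[0,\infty],\qquad \underline\beta=-\liminf_{t\to\infty}\frac1t\log\mathbb{P}(\log\|X\|>t)\in[0,\infty].$$ Conventions: $\log 0=-\infty$; for real $x\in(0,\infty)$ and $y\in\mathbb{R}$, $(\pm\infty+y)/x=\pm\infty$. *)

(* Defs.v *)
From HB Require Import structures.
From mathcomp Require Import all_boot all_order all_algebra.
From mathcomp Require Import all_classical all_reals all_analysis.
Set Implicit Arguments. Unset Strict Implicit. Unset Printing Implicit Defensive.
Import Order.TTheory GRing.Theory Num.Theory.
Import numFieldNormedType.Exports.
Local Open Scope classical_set_scope.
Local Open Scope ring_scope.

Definition separable_space (B : topologicalType) : Prop :=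
  exists D : set B, countable D /\ closure D = setT.

Definition borel_sets (B : topologicalType) : set (set B) := <<s open >>.

Definition borel_rv d (T : measurableType d) (B : topologicalType)
  (X : T -> B) : Prop :=
  forall A, borel_sets A -> measurable (X @^-1` A).

Local Open Scope ereal_scope.

Definition mutually_independent d (T : measurableType d) (R : realType)
  (P : probability T R) (B : topologicalType) (Xs : nat -> T -> B) : Prop :=
  forall (I : seq nat) (A : nat -> set B),
    uniq I -> (forall i, i \in I -> borel_sets (A i)) ->
    P (\bigcap_(i in [set` I]) (Xs i @^-1` A i))
    = \big[*%E/1%E]_(i <- I) P (Xs i @^-1` A i).

Definition same_distribution d (T : measurableType d) (R : realType)
  (P : probability T R) (B : topologicalType) (X Y : T -> B) : Prop :=
  forall A, borel_sets A -> P (X @^-1` A) = P (Y @^-1` A).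

(* Partial sums S_n = X_1 + ... + X_n  (X_i is [Xs i.-1], i.e. Xs is 0-indexed). *)
Definition partial_sum (T : Type) (R : realType) (B : normedModType R)
  (Xs : nat -> T -> B) (n : nat) : T -> B :=
  fun w => (\sum_(i < n) Xs i w)%R.

(* beta-bar and beta-underline of the random variable X:
   bbar = - limsup_{t -> oo} (1/t) log P(log ||X|| > t),
   bund = - liminf_{t -> oo} (1/t) log P(log ||X|| > t),
   with log 0 = -oo (lne) and (+-oo)/t = +-oo. *)
Definition log_tail d (T : measurableType d) (R : realType)
  (P : probability T R) (B : normedModType R) (X : T -> B) (t : R) : \bar R :=
  lne (P [set w | t%:E < lne (`|X w|)%:E]) * (t^-1)%:E.

Definition beta_bar d (T : measurableType d) (R : realType)
  (P : probability T R) (B : normedModType R) (X : T -> B) : \bar R :=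
  - limf_esup (log_tail P X) (+oo%R : set_system R).

Definition beta_under d (T : measurableType d) (R : realType)
  (P : probability T R) (B : normedModType R) (X : T -> B) : \bar R :=
  - limf_einf (log_tail P X) (+oo%R : set_system R).

Definition ld_seq d (T : measurableType d) (R : realType)
  (P : probability T R) (B : normedModType R) (Xs : nat -> T -> B)
  (p s : R) (n : nat) : \bar R :=
  lne (P [set w | (s * (n%:R `^ p^-1) < `|partial_sum Xs n w|)%R])
  * ((ln n%:R)^-1)%:E.

(* Main.v *)
(* Write [Q u = P(|X| > u)].  A single large summand gives
   [n Q(3 s n^(1/p)) <= 4 P(|S_n| > s n^(1/p))] for large [n]; in particular
   [Q u = O(u^-p)].  Conversely, truncate the summands at [n^gamma] with
   [gamma < 1/p].  The norm of the truncated sum is, up to a probability smaller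
   than every power of [n], within [o(n^(1/p))] of its mean: the second moment of
   a truncated summand is [O(n^(gamma (2 - p)))], and [p < 2] makes Bernstein's
   exponential bound effective.  The weak law forces that mean to be
   [o(n^(1/p))], so [P(|S_n| > s n^(1/p)) <= 4 n Q(n^gamma) + o(n^-k)] for every
   [k].  Letting [gamma] tend to [1/p], the two bounds have the same exponents.
   Both are first proved for finitely valued summands, where expectations are
   finite sums and independence is a product of weights, and transferred by
   approximating [X] along a dense sequence. *)
Require Import Defs.
From HB Require Import structures.
From mathcomp Require Import all_boot all_order all_algebra.
From mathcomp Require Import all_classical all_reals all_analysis.
From mathcomp Require Import ring lra.
Import Order.TTheory GRing.Theory Num.Theory.
Import numFieldNormedType.Exports.
Local Open Scope classical_set_scope.
Local Open Scope ring_scope.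

(** * Finitely valued i.i.d. summands *)

(** No geometry of the Banach space is available, so nothing is centred or symmetrized:
    concentration is proved for the real variable [|S_n|] about its own mean, by integrating out one
    summand at a time. The iterated sum [iidE] is made for this induction. A discretization serves
    only finitely many sums; it is chosen anew for each [n] and its errors vanish at fixed [n], so
    the constants must not depend on the number of values. Factors such as 3 and 4 disappear when
    logarithms are divided by [ln n], which permits crude estimates. There remains the passage
    between integers [n] and real [t]: the limsup or liminf of the tail may be approached along
    sparse [t] only, and monotonicity lets each such [t] be rounded to a suitable [n]. *)

Fixpoint iidE (R : realType) (K : finType) (q : K -> R) (n : nat)
    (f : seq K -> R) : R :=
  if n is m.+1 then \sum_k q k * iidE R K q m (fun l => f (k :: l)) else f [::].
Arguments iidE {R K}.

Section iid_expectation.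
Context {R : realType} {K : finType} (q : K -> R).
Implicit Types (f g : seq K -> R).

Lemma eq_iidE n f g : f =1 g -> iidE q n f = iidE q n g.
Proof.
elim: n f g => [|n ih] f g fg /=; first exact: fg.
by apply: eq_bigr => k _; congr (_ * _); apply: ih => l.
Qed.

Lemma iidED n f g : iidE q n (fun l => f l + g l) = iidE q n f + iidE q n g.
Proof.
elim: n f g => [//|n ih] f g /=.
by rewrite -big_split; apply: eq_bigr => k _; rewrite ih mulrDr.
Qed.

Lemma iidEZ n c f : iidE q n (fun l => c * f l) = c * iidE q n f.
Proof.
elim: n f => [//|n ih] f /=.
by rewrite mulr_sumr; apply: eq_bigr => k _; rewrite ih mulrCA.
Qed.

Lemma iidEB n f g : iidE q n (fun l => f l - g l) = iidE q n f - iidE q n g.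
Proof.
rewrite -mulN1r -iidEZ -iidED; apply: eq_iidE => l; by rewrite mulN1r.
Qed.

Lemma iidE_prod n (h : K -> R) :
  iidE q n (fun l => \prod_(k <- l) h k) = (\sum_k q k * h k) ^+ n.
Proof.
elim: n => [|n ih] /=; first by rewrite big_nil.
rewrite exprS mulr_suml; apply: eq_bigr => k _.
rewrite (@eq_iidE _ _ (fun l => h k * \prod_(j <- l) h j)).
  by rewrite iidEZ ih mulrA.
by move=> l; rewrite big_cons.
Qed.

Hypothesis q0 : forall k, 0 <= q k.

Lemma ler_iidE n f g : (forall l, f l <= g l) -> iidE q n f <= iidE q n g.
Proof.
elim: n f g => [|n ih] f g fg /=; first exact: fg.
by apply: ler_sum => k _; apply: ler_wpM2l => //; apply: ih => l.
Qed.

Hypothesis q1 : \sum_k q k = 1.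

Lemma iidE_cst n c : iidE q n (fun=> c) = c.
Proof. by elim: n => [//|n ih] /=; rewrite ih -mulr_suml q1 mul1r. Qed.

Lemma iidE_ge0 n f : (forall l, 0 <= f l) -> 0 <= iidE q n f.
Proof. by move=> f0; rewrite -(iidE_cst n 0); apply: ler_iidE. Qed.

(* Each entry of an i.i.d. list is independent of the sum of the others. *)
Lemma iidE_leave_one_out (V : zmodType) (b : K -> V) (phi : K -> R)
    (psi : V -> R) n x :
  iidE q n (fun l => \sum_(k <- l) phi k * psi (x + \sum_(j <- l) b j - b k)) =
  n%:R * (\sum_k q k * phi k) * iidE q n.-1 (fun l => psi (x + \sum_(j <- l) b j)).
Proof.
elim: n x => [|n ih] x /=; first by rewrite big_nil !mul0r.
pose e m y := iidE q m (fun l => psi (y + \sum_(j <- l) b j)).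
have step k : iidE q n (fun l => \sum_(i <- k :: l) phi i *
      psi (x + \sum_(j <- k :: l) b j - b i)) =
    phi k * e n x + n%:R * (\sum_k q k * phi k) * e n.-1 (x + b k).
  rewrite /e -ih -iidEZ -iidED; apply: eq_iidE => l.
  rewrite !big_cons; congr (_ * psi _ + _); last first.
    by apply: eq_bigr => i _; rewrite addrA.
  by rewrite addrCA addrAC subrr add0r.
under eq_bigr do rewrite step mulrDr mulrA.
rewrite big_split/= -mulr_suml -/(e n x).
under [X in _ + X]eq_bigr do rewrite mulrCA.
rewrite -mulr_sumr; case: n {ih step} => [|n].
  by rewrite /= !mul0r addr0 !mul1r.
have -> : \sum_k q k * e n.+1.-1 (x + b k) = e n.+1 x.
  rewrite /e/=; apply: eq_bigr => k _; congr (_ * _).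
  by apply: eq_iidE => l; rewrite big_cons addrA.
by rewrite -[n.+2%:R]natr1; ring.
Qed.

Lemma iidE_sum n (phi : K -> R) :
  iidE q n (fun l => \sum_(k <- l) phi k) = n%:R * (\sum_k q k * phi k).
Proof.
have := @iidE_leave_one_out R (fun=> 0) phi (fun=> 1) n 0.
rewrite iidE_cst mulr1 => <-; apply: eq_iidE => l.
by apply: eq_bigr => k _; rewrite mulr1.
Qed.

Lemma iidE_hasP n (P : pred K) :
  iidE q n (fun l => (has P l)%:R) <= n%:R * (\sum_k q k * (P k)%:R).
Proof.
rewrite -iidE_sum; apply: ler_iidE; elim=> [|k l ih]/=; first by rewrite big_nil.
rewrite big_cons; apply: le_trans (lerD (lexx _) ih).
by case: (P k) => /=; rewrite ?add0r// lerDl.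
Qed.

End iid_expectation.

Lemma prodr_1B_01 {R : realType} (K : Type) (phi : K -> R) (l : seq K) :
  (forall k, 0 <= phi k <= 1) -> 0 <= \prod_(k <- l) (1 - phi k) <= 1.
Proof.
move=> phi01; apply/andP; split.
  by apply: prodr_ge0 => k _; have := phi01 k; lra.
by apply: prodr_ile1 => k _; have := phi01 k; lra.
Qed.

Lemma ge1_sum_prod_1B {R : realType} (K : Type) (phi : K -> R) (l : seq K) :
  (forall k, 0 <= phi k <= 1) ->
  1 <= \prod_(k <- l) (1 - phi k) + \sum_(k <- l) phi k.
Proof.
move=> phi01; elim: l => [|k l ih]; first by rewrite !big_nil addr0.
rewrite !big_cons; have := phi01 k; have := prodr_1B_01 K phi l phi01.
nra.
Qed.

(** Each factor [1 - y] brings [1 + n.+1 y] down to at most [1 + n y]. A rational bound keeps the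
    later estimate polynomial. *)
Lemma expr_1B_le {R : realType} (y : R) n :
  0 <= y <= 1 -> (1 - y) ^+ n <= (1 + n%:R * y)^-1.
Proof.
move=> y01; rewrite -[leRHS]div1r ler_pdivlMr; last first.
  by have := ler0n R n; nra.
elim: n => [|n ih]; first by rewrite expr0 mul0r addr0 mul1r.
have h : 0 <= (1 - y) ^+ n by apply: exprn_ge0; lra.
apply: le_trans ih; rewrite exprSr -mulrA ler_wpM2l//.
by have := ler0n R n; rewrite -natr1; nra.
Qed.

(** Since [expR (- u) >= 1 - u], it suffices that [(1 - u) (1 + u + 2 u^2) = 1 + u^2 (1 - 2 u) >=
    1]. *)
Lemma expR_le1Dx2 {R : realType} (u : R) : `|u| <= 2^-1 -> expR u <= 1 + u + 2 * u ^+ 2.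
Proof.
rewrite ler_norml => u12.
have h : 1 - u <= expR (- u) by have := expR_ge1Dx (- u).
have h2 : expR u * expR (- u) = 1 by rewrite -expRD subrr expR0.
have := expR_gt0 u; nra.
Qed.

(** * Large summands, concentration and truncation for norms of i.i.d. sums *)

Section iid_sums.
Context {R : realType} {K : finType} (q : K -> R) {B : normedModType R}.
Hypothesis q0 : forall k, 0 <= q k.
Hypothesis q1 : \sum_k q k = 1.
Implicit Types b : K -> B.

Definition iidPr (q : K -> R) n (P : seq K -> bool) := iidE q n (fun l => (P l)%:R).

Lemma iidPr_le n (P1 P2 : seq K -> bool) : (forall l, P1 l -> P2 l) ->
  iidPr q n P1 <= iidPr q n P2.
Proof.
move=> h; apply: ler_iidE => // l; rewrite ler_nat.
by case: (P1 l) (h l) => // ->.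
Qed.

Lemma iidPr_or n (P P1 P2 : seq K -> bool) : (forall l, P l -> P1 l || P2 l) ->
  iidPr q n P <= iidPr q n P1 + iidPr q n P2.
Proof.
move=> h; rewrite -iidED; apply: ler_iidE => // l; rewrite -natrD ler_nat.
by case: (P l) (h l) => // /(_ isT); case: (P1 l); case: (P2 l).
Qed.

Lemma iidPr_exists n (P : seq K -> bool) : 0 < iidPr q n P -> exists l, P l.
Proof.
move=> h; apply: contrapT => /forallNP hP.
have : iidPr q n P <= iidE q n (fun=> 0).
  apply: ler_iidE => // l; by case: (P l) (hP l) => // /(_ isT).
by rewrite iidE_cst// leNgt h.
Qed.

Lemma iidPr_ge0 n (P : seq K -> bool) : 0 <= iidPr q n P.
Proof. exact: iidE_ge0. Qed.

(* A summand larger than [2T] makes the whole sum exceed [T] unless the other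
   summands add up to more than [T].  Weighting the large summands by [theta]
   brings their expected number down to [min 1 (n.+1 s)], so that the union
   bound loses only a constant factor. *)
Lemma one_big_summand b n T :
  iidPr q n (fun l => T < `|\sum_(k <- l) b k|) <= 4^-1 ->
  Num.min 1 (n.+1%:R * \sum_k q k * (2 * T < `|b k|)%R%:R) <=
  4 * iidPr q n.+1 (fun l => T < `|\sum_(k <- l) b k|).
Proof.
set c := iidPr q n _; set a := iidPr q n.+1 _; set s := \sum_k _ => c4.
have s0 : 0 <= s by apply: sumr_ge0 => k _; rewrite mulr_ge0.
have n0 : 0 < n.+1%:R :> R by rewrite ltr0n.
set m := Num.min 1 _.
have m1 : m <= 1 by rewrite /m ge_min lexx.
have ms : m <= n.+1%:R * s by rewrite /m ge_min lexx orbT.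
have m0 : 0 <= m by rewrite /m le_min ler01 mulr_ge0// ltW.
have [s00|s00] := eqVneq s 0.
  have -> : m = 0 by apply/eqP; rewrite eq_le m0 andbT; rewrite s00 mulr0 in ms.
  by rewrite mulr_ge0// iidPr_ge0.
have sgt0 : 0 < s by rewrite lt_neqAle eq_sym s00.
pose theta := m / (n.+1%:R * s).
have th0 : 0 <= theta by rewrite divr_ge0// mulr_ge0// ltW.
have th1 : theta <= 1 by rewrite ler_pdivrMr ?mulr_gt0// mul1r.
pose phi k := theta * (2 * T < `|b k|)%R%:R.
have phi01 k : 0 <= phi k <= 1.
  by rewrite /phi; case: (_ < _); rewrite ?mulr1 ?mulr0 ?lexx ?ler01// th0.
have sphi : \sum_k q k * phi k = theta * s.
  by rewrite /s mulr_sumr; apply: eq_bigr => k _; rewrite /phi mulrCA.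
have nts : n.+1%:R * (theta * s) = m.
  by rewrite /theta mulrCA -mulrA mulVf ?mulr1// mulf_neq0// gt_eqF.
have ts1 : 0 <= theta * s <= 1.
  rewrite mulr_ge0//=; apply: le_trans m1; rewrite -nts.
  by apply: ler_peMl; [exact: mulr_ge0|rewrite ler1n].
pose psi (v : B) : R := (T < `|v|)%R%:R.
(* The integrand is at most the indicator of [T < |S|]. If [|S| <= T], removing a summand larger
   than [2 T] leaves more than [T], so every [psi] that counts is 1 and the union bound makes the
   integrand nonpositive. *)
have key : iidE q n.+1 (fun l => 1 - \prod_(k <- l) (1 - phi k) -
    \sum_(k <- l) phi k * psi (0 + \sum_(j <- l) b j - b k)) <= a.
  apply: ler_iidE => // l; set S := \sum_(j <- l) b j; rewrite add0r.
  have [TS|ST] := ltP T `|S|.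
    rewrite /=; have := prodr_1B_01 K phi l phi01.
    suff : 0 <= \sum_(k <- l) phi k * psi (S - b k) by lra.
    by apply: sumr_ge0 => k _; have /andP[? _] := phi01 k; rewrite mulr_ge0.
  have -> : \sum_(k <- l) phi k * psi (S - b k) = \sum_(k <- l) phi k.
    apply: eq_bigr => k _; rewrite /phi /psi.
    have [Tb|] := ltP (2 * T) `|b k|; last by rewrite mulr0 mul0r.
    suff -> : T < `|S - b k| by rewrite !mulr1.
    have := ler_normB S (S - b k); rewrite subKr; lra.
  have := ge1_sum_prod_1B K phi l phi01; rewrite /=; lra.
have Eprod : iidE q n.+1 (fun l => \prod_(k <- l) (1 - phi k)) =
    (1 - theta * s) ^+ n.+1.
  rewrite iidE_prod; congr (_ ^+ _); rewrite -sphi -{2}q1 -sumrB.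
  by apply: eq_bigr => k _; rewrite mulrBr mulr1.
have Esum : iidE q n.+1 (fun l => \sum_(k <- l) phi k *
    psi (0 + \sum_(j <- l) b j - b k)) = m * c.
  rewrite iidE_leave_one_out// sphi nts; congr (_ * _).
  by apply: eq_iidE => l; rewrite add0r.
move: key; rewrite !iidEB iidE_cst// Eprod Esum => key.
(* With [m <= 1] and [c <= 1/4], [1 - (1 + m)^-1 - m c >= m/2 - m/4], whence the factor 4. *)
have := expr_1B_le _ n.+1 ts1; rewrite nts => hpow.
have h2 : (1 + m)^-1 <= 1 - m / 2.
  by rewrite -[leLHS]div1r ler_pdivrMr; nra.
nra.
Qed.

Lemma iidE_norm_lip b n x y :
  `|iidE q n (fun l => `|x + \sum_(k <- l) b k|) -
    iidE q n (fun l => `|y + \sum_(k <- l) b k|)| <= `|x - y|.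
Proof.
have h l : `| `|x + \sum_(k <- l) b k| - `|y + \sum_(k <- l) b k| | <= `|x - y|.
  by apply: le_trans (ler_dist_dist _ _) _; rewrite opprD addrACA subrr addr0.
rewrite -iidEB ler_norml; apply/andP; split.
  rewrite -[leLHS](iidE_cst q q1 n); apply: ler_iidE => // l.
  by have := h l; rewrite ler_norml => /andP[].
rewrite -[leRHS](iidE_cst q q1 n); apply: ler_iidE => // l.
by have := h l; rewrite ler_norml => /andP[].
Qed.

(* Bernstein's method, integrating out one summand at a time: the conditional
   mean is 1-Lipschitz in the partial sum. *)
Lemma iidE_expR_norm b (M V lambda : R) :
  (forall k, `|b k| <= M) -> \sum_k q k * `|b k| ^+ 2 <= V ->
  `|lambda| * M <= 2^-1 -> forall n x,
  iidE q n (fun l => expR (lambda * (`|x + \sum_(k <- l) b k| -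
    iidE q n (fun l => `|x + \sum_(k <- l) b k|)))) <=
  expR (n%:R * (2 * lambda ^+ 2 * V)).
Proof.
move=> bM bV lM; set v := 2 * _ * V.
pose g n x := iidE q n (fun l => `|x + \sum_(k <- l) b k|).
elim=> [|n ih] x; first by rewrite /= subrr mulr0 mul0r.
have gE : g n.+1 x = \sum_k q k * g n (x + b k).
  rewrite /g /=; apply: eq_bigr => k _; congr (q k * _).
  by apply: eq_iidE => l; rewrite big_cons addrA.
rewrite -/(g n.+1 x).
(* [h k] is the change of the conditional mean caused by the summand [b k], and [mu] is its
   average. *)
pose h k := g n (x + b k) - g n x.
pose mu := \sum_k q k * h k.
have muE : mu = g n.+1 x - g n x.
  rewrite /mu /h; under eq_bigr do rewrite mulrBr.
  by rewrite sumrB -mulr_suml q1 mul1r gE.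
have hb k : `|h k| <= `|b k|.
  by apply: le_trans (iidE_norm_lip _ _ _ _) _; rewrite addrC addKr.
have step k : iidE q n (fun l => expR (lambda *
      (`|x + \sum_(j <- k :: l) b j| - g n.+1 x))) <=
    expR (lambda * (h k - mu)) * expR (n%:R * v).
  apply: le_trans (ler_wpM2l (expR_ge0 _) (ih (x + b k))).
  rewrite -iidEZ; apply: ler_iidE => // l; rewrite -expRD ler_expR -/(g n _).
  by rewrite big_cons addrA muE /h; lra.
rewrite -natr1 mulrDl mul1r expRD mulrC [iidE _ _ _]/=.
apply: (@le_trans _ _ (\sum_k q k * (expR (lambda * (h k - mu)) * expR (n%:R * v)))).
  by apply: ler_sum => k _; apply: ler_wpM2l.
under eq_bigr do rewrite mulrA.
rewrite -mulr_suml; apply: ler_wpM2r; first exact: expR_ge0.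
(* The quadratic bound is applied to the uncentred [h k], which is the one bounded by [M]; the
   factor [expR (- (lambda * mu))] then cancels the linear term. *)
apply: (@le_trans _ _ (\sum_k q k * ((1 + lambda * h k + 2 * (lambda * h k) ^+ 2) *
    expR (- (lambda * mu))))).
  apply: ler_sum => k _; apply: ler_wpM2l => //.
  rewrite mulrBr expRD ler_wpM2r ?expR_ge0//; apply: expR_le1Dx2.
  rewrite normrM; apply: le_trans lM; apply: ler_wpM2l => //.
  exact: le_trans (hb k) (bM k).
under eq_bigr do rewrite mulrA.
rewrite -mulr_suml.
have h2 : \sum_k q k * (1 + lambda * h k + 2 * (lambda * h k) ^+ 2) <=
    1 + (lambda * mu + v).
  have -> : 1 + (lambda * mu + v) = 1 + lambda * mu + v by rewrite addrA.
  under eq_bigr do rewrite 2!mulrDr mulr1.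
  rewrite !big_split/= q1 !lerD//.
    by rewrite /mu mulr_sumr; under eq_bigr do rewrite mulrCA.
  have vE : v = (2 * lambda ^+ 2) * V by [].
  apply: (@le_trans _ _ ((2 * lambda ^+ 2) * \sum_k q k * `|b k| ^+ 2)).
    rewrite mulr_sumr; apply: ler_sum => k _.
    rewrite [leRHS]mulrCA ler_wpM2l// exprMn mulrA; apply: ler_wpM2l.
      by rewrite mulr_ge0// sqr_ge0.
    by rewrite -[h k ^+ 2]real_normK ?num_real// ler_sqr ?nnegrE.
  by rewrite vE ler_wpM2l// mulr_ge0// sqr_ge0.
apply: le_trans (ler_wpM2r (expR_ge0 _) (le_trans h2 (expR_ge1Dx _))) _.
by rewrite -expRD ler_expR; lra.
Qed.

Lemma iidPr_norm_gt_mean b (M V lambda r : R) n :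
  (forall k, `|b k| <= M) -> \sum_k q k * `|b k| ^+ 2 <= V ->
  0 <= lambda -> lambda * M <= 2^-1 ->
  let m := iidE q n (fun l => `|\sum_(k <- l) b k|) in
  let kappa := expR (n%:R * (2 * lambda ^+ 2 * V) - lambda * r) in
  iidPr q n (fun l => m + r < `|\sum_(k <- l) b k|) <= kappa /\
  iidPr q n (fun l => `|\sum_(k <- l) b k| < m - r) <= kappa.
Proof.
move=> bM bV l0 lM m kappa.
have aux (sg : R) : `|sg| = 1 ->
    iidPr q n (fun l => r < sg * (`|\sum_(k <- l) b k| - m)) <= kappa.
  move=> sg1; pose f l := expR (- (lambda * r)) *
    expR (sg * lambda * (`|0 + \sum_(k <- l) b k| - m)).
  apply: (@le_trans _ _ (iidE q n f)).
    apply: ler_iidE => // l; rewrite /f -expRD add0r.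
    have [rl|_] := ltP r; last exact: expR_ge0.
    by rewrite -expR0 ler_expR; nra.
  rewrite iidEZ /kappa addrC expRD ler_wpM2l ?expR_ge0//.
  have -> : m = iidE q n (fun l => `|0 + \sum_(k <- l) b k|).
    by apply: eq_iidE => l; rewrite add0r.
  have -> : lambda ^+ 2 = (sg * lambda) ^+ 2.
    by rewrite exprMn -[sg ^+ 2]real_normK ?num_real// sg1 expr1n mul1r.
  apply: iidE_expR_norm bM bV _ _ _.
  by rewrite normrM sg1 mul1r ger0_norm.
split.
  apply: le_trans (aux 1 (normr1 _)); apply: iidPr_le => l; lra.
by apply: le_trans (aux (-1) (normrN1 _)); apply: iidPr_le => l; lra.
Qed.

(** The mean [m] of the truncated norm is controlled without computing it: the norm is at least
    [m - r] by concentration and at most [r] by hypothesis, outside events of total probability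
    below 1. Some list satisfies both, so [m <= 2 * r]; a further deviation [r] gives [3 * r]. *)
Lemma iidPr_norm_truncated b (M V lambda r : R) n :
  0 <= M ->
  \sum_k q k * ((`|b k| <= M)%R%:R * `|b k| ^+ 2) <= V ->
  0 <= lambda -> lambda * M <= 2^-1 ->
  let kappa := expR (n%:R * (2 * lambda ^+ 2 * V) - lambda * r) in
  let big := n%:R * \sum_k q k * (M < `|b k|)%R%:R in
  kappa + (big + iidPr q n (fun l => r < `|\sum_(k <- l) b k|)) < 1 ->
  iidPr q n (fun l => 3 * r < `|\sum_(k <- l) b k|) <= big + kappa.
Proof.
move=> M0 bV l0 lM kappa big hlt.
pose b' k := if `|b k| <= M then b k else 0.
have b'M k : `|b' k| <= M by rewrite /b'; case: ifPn => //; rewrite normr0.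
have b'V : \sum_k q k * `|b' k| ^+ 2 <= V.
  apply: le_trans bV; apply: ler_sum => k _; rewrite ler_wpM2l// /b'.
  by case: ifPn => _; rewrite ?mul1r// normr0 expr0n mul0r.
have [] := @iidPr_norm_gt_mean b' M V lambda r n b'M b'V l0 lM.
set m := iidE _ _ _; rewrite -/kappa => up low.
have E l : ~~ has (fun k => M < `|b k|) l -> \sum_(k <- l) b k = \sum_(k <- l) b' k.
  elim: l => [|k l ih]/=; first by rewrite !big_nil.
  by rewrite negb_or -leNgt => /andP[bk /ih]; rewrite !big_cons => ->; rewrite /b' bk.
have hbig : iidPr q n (has (fun k => M < `|b k|)) <= big by exact: iidE_hasP.
have m2 : m <= 2 * r.
  have : 0 < iidPr q n (fun l => ~~ ((`|\sum_(k <- l) b' k| < m - r) ||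
      (r < `|\sum_(k <- l) b' k|))).
    set A := (X in 0 < X).
    have : 1 <= A + iidPr q n (fun l => (`|\sum_(k <- l) b' k| < m - r) ||
      (r < `|\sum_(k <- l) b' k|)).
      rewrite -[leLHS](iidE_cst q q1 n) /A -iidED; apply: ler_iidE => // l.
      by case: (_ || _); rewrite ?addr0 ?add0r.
    have : iidPr q n (fun l => (`|\sum_(k <- l) b' k| < m - r) ||
      (r < `|\sum_(k <- l) b' k|)) <= kappa + iidPr q n (fun l => r < `|\sum_(k <- l) b' k|).
      apply: le_trans (lerD low (lexx _)); exact: iidPr_or.
    have : iidPr q n (fun l => r < `|\sum_(k <- l) b' k|) <=
        iidPr q n (has (fun k => M < `|b k|)) + iidPr q n (fun l => r < `|\sum_(k <- l) b k|).
      by apply: iidPr_or => l; case: (boolP (has _ _)) => //= /E ->.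
    lra.
  by move=> /iidPr_exists[l]; rewrite negb_or -!leNgt; lra.
apply: le_trans (lerD hbig up); apply: iidPr_or => l.
by case: (boolP (has _ _)) => //= /E -> ; lra.
Qed.

(** On the shell between [2^J] and [2^(J+1)] the square is at most [4 * 4^J], so the moment grows by
    at most [4 C w^J]. As [w > 1] the geometric sum is of the order of its last term; the constant
    is fixed by [(k0 - 1) (w - 1) = 4 C], with 1 for the unit ball. *)
Lemma truncated_moment_dyadic b (C w : R) J :
  0 <= C -> 1 < w ->
  (forall i, (i <= J)%N ->
    (\sum_k q k * (2 ^+ i < `|b k|)%R%:R) * 4 ^+ i <= C * w ^+ i) ->
  \sum_k q k * ((`|b k| <= 2 ^+ J)%R%:R * `|b k| ^+ 2) <=
  (1 + 4 * C / (w - 1)) * w ^+ J.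
Proof.
move=> C0 w1; set k0 := 1 + _; have k0E : (k0 - 1) * (w - 1) = 4 * C.
  by rewrite /k0 addrAC subrr add0r divfK// subr_eq0 gt_eqF.
elim: J => [|J ih] hC.
  apply: (@le_trans _ _ 1).
    rewrite -[leRHS]q1; apply: ler_sum => k _; rewrite -[leRHS]mulr1 ler_wpM2l//.
    have [h|_] := leP `|b k| (2 ^+ 0); last by rewrite mul0r.
    by rewrite expr0 in h; rewrite mul1r expr_le1.
  by rewrite expr0 mulr1 lerDl divr_ge0 ?mulr_ge0//; lra.
have {}ih := ih (fun i iJ => hC i (leqW iJ)).
have hJ := hC J (leqnSn J).
apply: (@le_trans _ _ (\sum_k q k * ((`|b k| <= 2 ^+ J)%R%:R * `|b k| ^+ 2) +
   4 * ((\sum_k q k * (2 ^+ J < `|b k|)%R%:R) * 4 ^+ J))).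
  rewrite mulr_suml mulr_sumr -big_split/=; apply: ler_sum => k _.
  rewrite -[_ * _ * 4 ^+ J]mulrA [4 * (q k * _)]mulrCA -mulrDr ler_wpM2l//.
  have [h|h] := leP `|b k| (2 ^+ J).
    by rewrite mul0r mulr0 addr0 ler_wpM2r ?sqr_ge0// lern1 leq_b1.
  rewrite mul0r add0r mul1r -exprS.
  have [h2|_] := leP `|b k| (2 ^+ J.+1); last by rewrite mul0r exprn_ge0.
  rewrite mul1r.
  have -> : 4 ^+ J.+1 = (2 ^+ J.+1) ^+ 2 :> R.
    by rewrite exprAC -[in RHS]natrX.
  by rewrite ler_sqr ?nnegrE ?exprn_ge0.
have wJ : 1 <= w ^+ J by rewrite exprn_ege1// ltW.
rewrite exprS; nra.
Qed.

End iid_sums.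

(** * Approximation by finitely valued summands *)

Section separable.
Context {R : realType} {B : normedModType R}.

Lemma separable_dense_seq : separable_space B ->
  exists e : nat -> B, forall x (r : R), 0 < r -> exists j, `|x - e j| < r.
Proof.
move=> [D [/pfcard_geP[->|/unsquash f] clD]].
  have := clD; rewrite closure0 => /seteqP[_ /(_ 0 I)]; by [].
exists f => x r r0; have : closure D x by rewrite clD.
move=> /(_ (ball x r)) /(_ (nbhsx_ballx _ _ r0))[y [Dy]].
rewrite -ball_normE /= => xy.
have [j _ fj] := @surj _ _ _ _ f _ Dy.
by exists j; rewrite fj.
Qed.

Lemma open_norm_gt (t : R) : open [set x : B | t < `|x|].
Proof.
have -> : [set x : B | t < `|x|] = Num.norm @^-1` [set y | t < y].
  by [].
by apply: open_comp; [move=> x _; exact: norm_continuous|exact: open_gt].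
Qed.

Lemma open_ball_norm (a : B) (r : R) : open [set x : B | `|x - a| < r].
Proof.
have [r0|r0] := ltP 0 r; last first.
  rewrite [X in open X](_ : _ = set0); first exact: open0.
  apply/seteqP; split => // x /=.
  by move=> /(le_lt_trans (normr_ge0 _)); rewrite ltNge r0.
have -> : [set x : B | `|x - a| < r] = ball a r.
  by rewrite -ball_normE; apply/seteqP; split => x /=; rewrite distrC.
exact: ball_open.
Qed.

Context {d} {T : measurableType d} (e : nat -> B).
Hypothesis eP : forall x (r : R), 0 < r -> exists j, `|x - e j| < r.

(** Separability is used here: the event is a countable union over pairs of small balls centred on
    the dense sequence. *)
Lemma measurable_open_preimageD (X Y : T -> B) :
  (forall U, open U -> measurable (X @^-1` U)) ->
  (forall U, open U -> measurable (Y @^-1` U)) ->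
  forall U, open U -> measurable ((fun w => X w + Y w) @^-1` U).
Proof.
move=> mX mY U oU.
(* This condition does not involve [w], so the corresponding set is full or empty. The radius adds
   the errors of both summands. *)
pose good i j m := forall z : B, `|z - (e i + e j)| < 2 / m.+1%:R -> U z.
pose F i j m := (X @^-1` [set x | `|x - e i| < m.+1%:R^-1]) `&`
  (Y @^-1` [set y | `|y - e j| < m.+1%:R^-1]) `&` [set _ | good i j m].
have -> : (fun w => X w + Y w) @^-1` U =
    \bigcup_i \bigcup_j \bigcup_m F i j m.
  apply/seteqP; split => [w /= Uw|w [i _ [j _ [m _ [[/= Xi Yj] gd]]]]]; last first.
    apply: gd; rewrite opprD addrACA; apply: le_lt_trans (ler_normD _ _) _.
    by rewrite mulrDl mul1r ltrD.
  have := oU; rewrite openE => /(_ _ Uw) /nbhs_ballP[r /= r0 rU].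
  have [m /= mr] : exists m : nat, 4 / r < m%:R.
    by exists (Num.truncn (4 / r)).+1; rewrite truncnS_gt// divr_ge0// ltW.
  have m0 : 0 < m.+1%:R^-1 :> R by rewrite invr_gt0.
  have mr' : 4 * m.+1%:R^-1 < r.
    rewrite ltr_pdivrMr// mulrC -ltr_pdivrMr//; apply: lt_trans mr _.
    by rewrite ltr_nat.
  have [i Xi] := eP (X w) m.+1%:R^-1 m0.
  have [j Yj] := eP (Y w) m.+1%:R^-1 m0.
  exists i => //; exists j => //; exists m => //; split => //= z hz.
  apply: rU; rewrite -ball_normE /=.
  have -> : X w + Y w - z = (X w - e i) + (Y w - e j) - (z - (e i + e j)).
    by rewrite [in RHS]addrACA -opprD opprB addrA subrK.
  apply: le_lt_trans (ler_normB _ _) _.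
  have := ler_normD (X w - e i) (Y w - e j).
  by move: hz Xi Yj mr' m0; set u := m.+1%:R^-1; lra.
apply: bigcupT_measurable => i; apply: bigcupT_measurable => j.
apply: bigcupT_measurable => m; apply: measurableI.
  apply: measurableI; [apply: mX|apply: mY]; exact: open_ball_norm.
have [g|g] := pselect (good i j m).
  by rewrite [X in measurable X](_ : _ = setT)//; apply/seteqP; split.
by rewrite [X in measurable X](_ : _ = set0)//; apply/seteqP; split => // x [].
Qed.

Lemma measurable_open_partial_sum (Xs : nat -> T -> B) n :
  (forall i U, open U -> measurable (Xs i @^-1` U)) ->
  forall U, open U -> measurable (partial_sum Xs n @^-1` U).
Proof.
move=> mX; elim: n => [|n ih] U oU.
  have [U0|U0] := pselect (U 0).
    rewrite [X in measurable X](_ : _ = setT)//; apply/seteqP; split => // w _ /=.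
    by rewrite /partial_sum big_ord0.
  rewrite [X in measurable X](_ : _ = set0)//; apply/seteqP; split => // w /=.
  by rewrite /partial_sum big_ord0.
have -> : partial_sum Xs n.+1 = (fun w => partial_sum Xs n w + Xs n w).
  by apply/funext => w; rewrite /partial_sum big_ord_recr.
by apply: measurable_open_preimageD => //; exact: mX.
Qed.

Let bT := g_sigma_algebraType (@open B).

(** This quantizes [x]. [find] returns [size s] when no listed point is close, which labels the
    leftover cell; for [s = iota 0 N] positions and indices agree. *)
Definition first_close_index (delta : R) (s : seq nat) (x : B) :=
  find (fun j => `|x - e j| < delta) s.

Lemma borel_first_close_index delta s k :
  borel_sets [set x | first_close_index delta s x = k].
Proof.
suff : measurable ([set x | first_close_index delta s x = k] : set bT) by [].
have mb j : measurable ([set x | `|x - e j| < delta] : set bT).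
  by apply: sub_sigma_algebra; exact: open_ball_norm.
elim: s k => [|j s ih] k.
  have [k0|k0] := eqVneq 0%N k.
    by rewrite [X in measurable X](_ : _ = setT)//; apply/seteqP; split.
  rewrite [X in measurable X](_ : _ = set0)//; apply/seteqP; split => // x /=.
  by move/eqP; rewrite (negbTE k0).
case: k => [|k].
  rewrite [X in measurable X](_ : _ = [set x | `|x - e j| < delta])//.
  by apply/seteqP; split => x; rewrite /first_close_index/=; case: ifP.
rewrite [X in measurable X](_ : _ = (~` [set x | `|x - e j| < delta]) `&`
    [set x | first_close_index delta s x = k]).
  by apply: measurableI => //; apply: measurableC.
apply/seteqP; split => x; rewrite /first_close_index/=; case: ifP => //=.
- by move=> _ [->].
- by move=> _ [] /(_ isT).
- by move=> _ [_ ->].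
Qed.

End separable.

(** * Joint law of a quantized i.i.d. sequence *)

Section discretization.
Context {R : realType} {d} {T : measurableType d} (P : probability T R).

Local Notation Pr A := (fine (P A)).

Lemma fine_probK A : measurable A -> (Pr A)%:E = P A.
Proof. by move=> mA; rewrite fineK// fin_num_measure. Qed.

Lemma Pr_ge0 A : 0 <= Pr A. Proof. by rewrite fine_ge0. Qed.

Lemma Pr_le1 A : measurable A -> Pr A <= 1.
Proof. by move=> mA; rewrite -lee_fin fine_probK// probability_le1. Qed.

Lemma le_Pr A C : measurable A -> measurable C -> A `<=` C -> Pr A <= Pr C.
Proof. by move=> mA mC AC; rewrite -lee_fin !fine_probK// le_measure// inE. Qed.

Lemma le_PrU A C D : measurable A -> measurable C -> measurable D ->
  A `<=` C `|` D -> Pr A <= Pr C + Pr D.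
Proof.
move=> mA mC mD ACD; rewrite -lee_fin EFinD !fine_probK//.
apply: le_trans (measureU2 _ mC mD); apply: le_measure; rewrite ?inE//.
exact: measurableU.
Qed.

Lemma Pr_partition N (Z : T -> 'I_N.+1) E : measurable E ->
  (forall k, measurable (Z @^-1` [set k])) ->
  Pr E = \sum_k Pr (E `&` Z @^-1` [set k]).
Proof.
move=> mE mZ; apply: EFin_inj; rewrite -sumEFin fine_probK//.
transitivity (\sum_k P (E `&` Z @^-1` [set k]))%E; last first.
  by apply: eq_bigr => k _; rewrite fine_probK//; exact: measurableI.
pose F i := E `&` [set w | Z w = i :> nat].
have mF i : measurable (F i).
  apply: measurableI => //; have [iN|iN] := ltnP i N.+1.
    rewrite [X in measurable X](_ : _ = Z @^-1` [set Ordinal iN])//.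
    by apply/seteqP; split => w /=; [move=> h; exact/val_inj|move=> ->].
  rewrite [X in measurable X](_ : _ = set0)//; apply/seteqP; split => // w /= h.
  by have := ltn_ord (Z w); rewrite h ltnNge iN.
have tF : trivIset setT F.
  apply/trivIsetP => i j _ _ /eqP ij; apply/seteqP; split => // w [[_ Zi] [_ Zj]].
  by apply: ij; rewrite -Zi -Zj.
transitivity (P (\big[setU/set0]_(i < N.+1) F i)).
  congr (P _); rewrite -bigcup_mkord.
  by apply/seteqP; split => [w Ew|w [i _ []]//]; exists (Z w); first exact: ltn_ord.
rewrite measure_bigsetU//; apply: eq_bigr => k _; congr (P _).
apply/seteqP; split => w [Ew /= Zk]; split => //=; last by rewrite Zk.
exact/val_inj.
Qed.

Context {B : topologicalType} (Xs : nat -> T -> B).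
Hypothesis bX : forall n, borel_rv (Xs n).
Hypothesis iX : mutually_independent P Xs.
Context (X : T -> B).
Hypothesis bX0 : borel_rv X.
Hypothesis sX : forall n, same_distribution P (Xs n) X.
Context (N : nat) (Y : B -> 'I_N.+1).
Hypothesis mY : forall k, borel_sets (Y @^-1` [set k]).

Let q k := Pr (X @^-1` (Y @^-1` [set k])).
Let Zseq m n w := [seq Y (Xs i w) | i <- iota m n].

Lemma measurable_Zseq m n (f : seq 'I_N.+1 -> bool) :
  measurable [set w | f (Zseq m n w)].
Proof.
elim: n m f => [|n ih] m f.
  rewrite /Zseq/=; case: (f [::]).
    by rewrite [X in measurable X](_ : _ = setT)//; apply/seteqP; split.
  by rewrite [X in measurable X](_ : _ = set0)//; apply/seteqP; split.
rewrite [X in measurable X](_ : _ = \big[setU/set0]_(k < N.+1)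
   ((Xs m @^-1` (Y @^-1` [set k])) `&` [set w | f (k :: Zseq m.+1 n w)])).
  apply: bigsetU_measurable => k _; apply: measurableI; first exact: bX.
  exact: (ih _ (fun l => f (k :: l))).
rewrite -bigcup_mkord_ord; apply/seteqP; split => w /=.
  by move=> h; exists (Y (Xs m w)); [exact: ltn_ord|rewrite /= inord_val].
by move=> [k _ [/= <-]].
Qed.

Lemma Pr_prefix m (l : seq 'I_N.+1) : size l = m ->
  Pr [set w | Zseq 0 m w == l] = \prod_(k <- l) q k.
Proof.
move=> lm; pose A i := Y @^-1` [set nth ord0 l i].
have := iX (iota 0 m) A (iota_uniq _ _) (fun i _ => mY _).
have -> : \bigcap_(i in [set` iota 0 m]) (Xs i @^-1` A i) = [set w | Zseq 0 m w == l].
  apply/seteqP; split => w /=.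
    move=> h; apply/eqP; apply: (@eq_from_nth _ ord0); rewrite size_map size_iota// => i im.
    rewrite (nth_map 0%N) ?size_iota// nth_iota// add0n.
    by apply: h; rewrite /= mem_iota.
  move=> /eqP h i; rewrite /= mem_iota/= add0n => im.
  by rewrite /A /= -h /Zseq (nth_map 0%N) ?size_iota// nth_iota.
move=> h; apply: EFin_inj; rewrite fine_probK ?h; last exact: (measurable_Zseq 0 m (fun s => s == l)).
have -> : (\prod_(k <- l) q k)%:E = \big[*%E/1%E]_(k <- l) (q k)%:E.
  by rewrite (big_morph EFin EFinM erefl).
rewrite (big_nth ord0) lm /index_iota subn0; apply: eq_bigr => i _.
by rewrite /q fine_probK; [exact: (sX i _ (mY _))|exact: (bX0 _ (mY _))].
Qed.

(** Independence only gives the probability of a full list of values. Carrying a prefix [l] and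
    splitting on the next value reproduces the recursion of [iidE]. *)
Lemma Pr_Zseq_prefix n m (l : seq 'I_N.+1) (f : seq 'I_N.+1 -> bool) : size l = m ->
  Pr ([set w | Zseq 0 m w == l] `&` [set w | f (Zseq m n w)]) =
  \prod_(k <- l) q k * iidPr q n f.
Proof.
elim: n m l f => [|n ih] m l f lm.
  rewrite /iidPr /Zseq/=; case: (f [::]) => /=.
    rewrite mulr1 -(Pr_prefix m l)//; congr (fine (P _)).
    by apply/seteqP; split => w // [].
  rewrite mulr0 [X in P X](_ : _ = set0) ?measure0//.
  by apply/seteqP; split => w // [].
rewrite (Pr_partition _ (fun w => Y (Xs m w))); last 2 first.
  - by apply: measurableI; [exact: (measurable_Zseq 0 m (fun s => s == l))|exact: measurable_Zseq].
  - by move=> k; exact: (bX m _ (mY k)).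
rewrite [RHS]mulr_sumr; apply: eq_bigr => k _.
have -> : [set w | Zseq 0 m w == l] `&` [set w | f (Zseq m n.+1 w)] `&`
    (fun w => Y (Xs m w)) @^-1` [set k] =
    [set w | Zseq 0 m.+1 w == rcons l k] `&` [set w | f (k :: Zseq m.+1 n w)].
  have E w : Zseq 0 m.+1 w = rcons (Zseq 0 m w) (Y (Xs m w)).
    rewrite /Zseq; have -> : iota 0 m.+1 = rcons (iota 0 m) m by rewrite -addn1 iotaD cats1.
    by rewrite map_rcons.
  apply/seteqP; split => w /=; rewrite E eqseq_rcons.
    by move=> [[/eqP -> h] Yk]; rewrite Yk !eqxx; split => //; rewrite -Yk.
  by move=> [/andP[lE /eqP Yk]]; rewrite -{1}Yk.
rewrite (ih m.+1 (rcons l k) (fun s => f (k :: s))) ?size_rcons ?lm//.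
by rewrite -cats1 big_cat/= big_seq1 -mulrA.
Qed.

Lemma Pr_Zseq n (f : seq 'I_N.+1 -> bool) :
  Pr [set w | f (Zseq 0 n w)] = iidPr q n f.
Proof.
have := Pr_Zseq_prefix n 0 [::] f erefl.
rewrite big_nil mul1r => <-; congr (fine (P _)).
by apply/seteqP; split => w //= [].
Qed.

Lemma cell_prob_ge0 k : 0 <= q k. Proof. exact: Pr_ge0. Qed.

Lemma sum_cell_prob : \sum_k q k = 1.
Proof.
have := Pr_Zseq 1 xpredT; rewrite /iidPr /=.
under [in RHS]eq_bigr do rewrite mulr1.
move=> <-; rewrite [X in P X](_ : _ = setT) ?probability_setT//.
by apply/seteqP; split.
Qed.

End discretization.

Section tail_discretization.
Context {R : realType} {d} {T : measurableType d} (P : probability T R).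
Context {B : normedModType R} (e : nat -> B).
Hypothesis eP : forall x (r : R), 0 < r -> exists j, `|x - e j| < r.
Context (X : T -> B) (Xs : nat -> T -> B).
Hypothesis bX0 : borel_rv X.
Hypothesis bX : forall n, borel_rv (Xs n).
Hypothesis iX : mutually_independent P Xs.
Hypothesis sX : forall n, same_distribution P (Xs n) X.

Definition sum_tail (m : nat) (t : R) : R :=
  fine (P [set w | t < `|partial_sum Xs m w|]).

Lemma measurable_sum_tail m (t : R) : measurable [set w | t < `|partial_sum Xs m w|].
Proof.
apply: (measurable_open_partial_sum e eP Xs m _ [set x | t < `|x|]).
  by move=> i U oU; apply: bX; exact: sub_sigma_algebra.
exact: open_norm_gt.
Qed.

Lemma sum_tail_ge0 m t : 0 <= sum_tail m t.
Proof. exact: Pr_ge0. Qed.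

Lemma sum_tail_le1 m t : sum_tail m t <= 1.
Proof. by apply: Pr_le1; exact: measurable_sum_tail. Qed.

Lemma le_sum_tail m s t : s <= t -> sum_tail m t <= sum_tail m s.
Proof.
move=> st; apply: le_Pr; [exact: measurable_sum_tail|exact: measurable_sum_tail|].
by move=> w /=; exact: le_lt_trans.
Qed.

(** By density the leftover cells decrease to the empty set as [N] grows; continuity from above
    applies. *)
Lemma far_from_dense_seq (delta eta : R) : 0 < delta -> 0 < eta -> exists N,
  fine (P (X @^-1` [set x | first_close_index e delta (iota 0 N) x = N])) < eta.
Proof.
move=> delta0 eta0.
pose F N := X @^-1` [set x | first_close_index e delta (iota 0 N) x = N].
have mF N : measurable (F N) by apply: bX0; exact: borel_first_close_index.
have FE N w : F N w <-> forall j, (j < N)%N -> delta <= `|X w - e j|.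
  rewrite /F /= /first_close_index; split.
    move=> h j jN; rewrite leNgt.
    pose near_e j := `|X w - e j| < delta.
    have := @before_find _ 0%N near_e (iota 0 N) j.
    by rewrite h => /(_ jN); rewrite nth_iota// add0n /near_e => ->.
  move=> h; rewrite hasNfind ?size_iota//; apply/hasPn => j.
  by rewrite mem_iota add0n /= -leNgt => /h.
have capF : \bigcap_N F N = set0.
  apply/seteqP; split => // w hw; have [j] := eP (X w) delta delta0.
  by have /FE/(_ j (ltnSn j)) := hw j.+1 I; rewrite leNgt => /negP.
have := @nonincreasing_cvg_mu _ _ _ P F _ mF.
rewrite capF measure0 => /(_ _ measurable0) h.
have {}h : (P \o F) x @[x --> \oo] --> 0%E.
  apply: h; first by rewrite ltey_eq fin_num_measure.
  move=> n m nm; apply/subsetPset => w /FE h; apply/FE => j jn.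
  by apply: h; exact: leq_trans nm.
have /fine_cvgP[_ /cvgr0Pnorm_lt/(_ _ eta0)[N _ hN]] := h.
exists N; have := hN N (leqnn N); rewrite /= ger0_norm//.
by rewrite fine_ge0.
Qed.

(** One choice of [q] and [b] serves all [m <= n], because the estimates compare sums of different
    lengths, in particular [m = 1]. Each summand may move by [delta / n.+1] and fall into the
    leftover cell with probability below [eta / n.+1]. *)
Lemma tail_discretization n (delta eta : R) : 0 < delta -> 0 < eta ->
  exists N (q : 'I_N.+1 -> R) (b : 'I_N.+1 -> B),
    [/\ forall k, 0 <= q k, \sum_k q k = 1 & forall m t, (m <= n)%N ->
      sum_tail m (t + delta) - eta <=
        iidPr q m (fun l => t < `|\sum_(k <- l) b k|) /\
      iidPr q m (fun l => t < `|\sum_(k <- l) b k|) <=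
        sum_tail m (t - delta) + eta].
Proof.
move=> delta0 eta0; have n0 : 0 < n.+1%:R :> R by rewrite ltr0n.
pose delta' := delta / n.+1%:R; have delta'0 : 0 < delta' by rewrite divr_gt0.
have [N hN] := far_from_dense_seq _ (eta / n.+1%:R) delta'0 (divr_gt0 eta0 n0).
pose Y x : 'I_N.+1 := inord (first_close_index e delta' (iota 0 N) x).
have YE x : Y x = first_close_index e delta' (iota 0 N) x :> nat.
  by rewrite inordK// ltnS -[leqRHS](size_iota 0 N) find_size.
have mY k : borel_sets (Y @^-1` [set k]).
  rewrite [X in borel_sets X](_ : _ = [set x | first_close_index e delta' (iota 0 N) x = k]).
    exact: borel_first_close_index.
  apply/seteqP; split => x /=; first by move=> <-; rewrite YE.
  by move=> h; apply/val_inj; rewrite /= YE.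
pose q k := fine (P (X @^-1` (Y @^-1` [set k]))).
have q0 k : 0 <= q k by exact: cell_prob_ge0.
have q1 : \sum_k q k = 1 by apply: sum_cell_prob bX0 sX _ _ mY.
have law := Pr_Zseq P Xs bX iX X bX0 sX N Y mY.
have mZ := measurable_Zseq Xs bX N Y mY.
pose b (k : 'I_N.+1) := if (k < N)%N then e k else 0.
exists N, q, b; split => // m t mn.
pose Z m w := [seq Y (Xs i w) | i <- iota 0 m].
have qmax : q ord_max < eta / n.+1%:R.
  apply: le_lt_trans hN; rewrite /q le_eqVlt; apply/orP; left; apply/eqP.
  congr (fine (P _)); apply/seteqP; split => w /=; first by move/(congr1 val); rewrite /= YE.
  by move=> h; apply/val_inj; rewrite /= YE.
pose bad := [set w | has (pred1 ord_max) (Z m w)].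
have mbad : measurable bad by exact: mZ.
have Pbad : fine (P bad) <= eta.
  rewrite law; apply: le_trans (iidE_hasP q q0 q1 m (pred1 ord_max)) _.
  rewrite (bigD1 ord_max)//= eqxx mulr1 big1 ?addr0; last first.
    by move=> k /negPf ->; rewrite mulr0.
  apply: (@le_trans _ _ (n.+1%:R * (eta / n.+1%:R))).
    by apply: ler_pM => //; [rewrite ler_nat leqW|exact: ltW].
  by rewrite mulrC divfK// gt_eqF.
have close w : ~ bad w -> `|partial_sum Xs m w - \sum_(k <- Z m w) b k| <= delta.
  move=> /negP/hasPn hbad.
  have -> : partial_sum Xs m w = \sum_(i <- iota 0 m) Xs i w.
    by rewrite /partial_sum -(big_mkord xpredT (fun i => Xs i w)) /index_iota subn0.
  rewrite big_map -sumrB.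
  apply: (@le_trans _ _ (\sum_(i <- iota 0 m) delta')).
    rewrite big_seq [leRHS]big_seq; apply: le_trans (ler_norm_sum _ _ _) _.
    apply: ler_sum => i im.
    have /hbad/= : Y (Xs i w) \in Z m w by apply/mapP; exists i.
    rewrite -(inj_eq val_inj)/= YE => ne.
    have lt : (first_close_index e delta' (iota 0 N) (Xs i w) < N)%N.
      by rewrite ltn_neqAle ne/= -[leqRHS](size_iota 0 N) find_size.
    rewrite /b YE lt ltW//.
    pose near_e j := `|Xs i w - e j| < delta'.
    have := @nth_find _ 0%N near_e (iota 0 N).
    by rewrite has_find size_iota => /(_ lt); rewrite nth_iota.
  rewrite big_const_seq count_predT size_iota iter_addr_0 -[_ *+ m]mulr_natr.
  by rewrite /delta' mulrAC ler_pdivrMr// ler_wpM2l ?ltW// ltr_nat ltnS.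
have mbig := mZ 0%N m (fun l => t < `|\sum_(k <- l) b k|).
rewrite -!law; split.
  rewrite lerBlDr; apply: le_trans (lerD (lexx _) Pbad).
  apply: le_PrU => //; first exact: measurable_sum_tail.
  move=> w /= tS; have [bw|bw] := pselect (bad w); first by right.
  left; rewrite -/(Z m w); have := close _ bw.
  have := ler_dist_dist (partial_sum Xs m w) (\sum_(k <- Z m w) b k).
  by move: tS; have := ler_norm (`|partial_sum Xs m w| - `|\sum_(k <- Z m w) b k|); lra.
apply: le_trans (lerD (lexx _) Pbad).
apply: le_PrU => //; first exact: measurable_sum_tail.
move=> w /= tS; have [bw|bw] := pselect (bad w); first by right.
left; have := close _ bw; rewrite distrC.
have := ler_dist_dist (\sum_(k <- Z m w) b k) (partial_sum Xs m w).
move: tS; rewrite -/(Z m w).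
by have := ler_norm (`|\sum_(k <- Z m w) b k| - `|partial_sum Xs m w|); lra.
Qed.

End tail_discretization.

(** * From tail bounds to exponents *)

Local Open Scope ereal_scope.

Lemma lte_real_between {R : realType} (x y : \bar R) : x < y ->
  exists r : R, x < r%:E /\ r%:E < y.
Proof.
case: x => [x| |]; case: y => [y| |]//.
- by rewrite lte_fin => xy; exists ((x + y) / 2)%R; rewrite !lte_fin; lra.
- by move=> _; exists (x + 1)%R; rewrite lte_fin ltry; split => //; lra.
- by move=> _; exists (y - 1)%R; rewrite lte_fin ltNyr; split => //; lra.
- by move=> _; exists 0%R; rewrite ltNyr ltry.
Qed.

(** * Limsup and liminf along a filter, tested on real thresholds *)

Section limf_threshold.
Context {T : choiceType} {X : filteredType T} {R : realType}.
Variables (F : set_system X).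
Hypothesis FF : Filter F.
Implicit Types (f : X -> \bar R) (L : \bar R).

Lemma limf_esup_le f L :
  (forall y : R, L < y%:E -> F [set x | f x <= y%:E]) -> limf_esup f F <= L.
Proof.
move=> h; rewrite leNgt; apply/negP => /lte_real_between[r [Lr]].
apply/negP; rewrite -leNgt; apply: (@le_trans _ _ (ereal_sup (f @` [set x | f x <= r%:E]))).
  by apply: ereal_inf_lbound; exists [set x | f x <= r%:E] => //; exact: h.
by apply: ge_ereal_sup => _ [x /= fx <-].
Qed.

Lemma limf_esup_lt_near f L : limf_esup f F < L -> F [set x | f x < L].
Proof.
move=> /ereal_inf_lt[_ [V FV <-]] h; apply: filterS FV => x Vx /=.
by apply: le_lt_trans h; apply: ereal_sup_ubound; exists x.
Qed.

Lemma limf_esup_gt_ex f L V : L < limf_esup f F -> F V -> exists2 x, V x & L < f x.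
Proof.
move=> h FV; have : L < ereal_sup (f @` V).
  by apply: lt_le_trans h _; apply: ereal_inf_lbound; exists V.
by move=> /ereal_sup_gt[_ [x Vx <-]]; exists x.
Qed.

Lemma limf_esup_ge f L :
  (forall y : R, y%:E < L -> forall V, F V -> exists2 x, V x & y%:E <= f x) ->
  L <= limf_esup f F.
Proof.
move=> h; rewrite leNgt; apply/negP => /lte_real_between[r [rL Lr]].
have [x /= fx] := h _ Lr _ (limf_esup_lt_near f r%:E rL).
by apply/negP; rewrite -ltNge.
Qed.

Lemma limf_einf_ge f L :
  (forall y : R, y%:E < L -> F [set x | y%:E <= f x]) -> L <= limf_einf f F.
Proof.
move=> h; rewrite /limf_einf leeNr; apply: limf_esup_le => y Ly.
have := h (- y)%R; rewrite EFinN lteNl => /(_ Ly).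
by apply: filterS => x /=; rewrite leeNl.
Qed.

Lemma limf_einf_gt_near f L : L < limf_einf f F -> F [set x | L < f x].
Proof.
rewrite /limf_einf lteNr => /limf_esup_lt_near.
by apply: filterS => x /=; rewrite lteNl oppeK.
Qed.

Lemma limf_einf_lt_ex f L V : limf_einf f F < L -> F V -> exists2 x, V x & f x < L.
Proof.
rewrite /limf_einf lteNl => /limf_esup_gt_ex h /h[x Vx].
by rewrite lteNl oppeK; exists x.
Qed.

Lemma limf_einf_le f L :
  (forall y : R, L < y%:E -> forall V, F V -> exists2 x, V x & f x <= y%:E) ->
  limf_einf f F <= L.
Proof.
move=> h; rewrite /limf_einf leeNl; apply: limf_esup_ge => y yL V FV.
have := h (- y)%R; rewrite EFinN lteNr => /(_ yL _ FV)[x Vx fx].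
by exists x => //; rewrite leeNr.
Qed.

End limf_threshold.

Lemma cvg_limn_esup_einf {R : realType} (u : (\bar R)^nat) l :
  limn_esup u = l -> limn_einf u = l -> u @ \oo --> l.
Proof.
move=> ul lu; apply: (@squeeze_cvge _ _ _ _ (einfs u) u (esups u)).
- apply: nearW => n; apply/andP; split.
    by apply: ereal_inf_lbound; exists n => /=.
  by apply: ereal_sup_ubound; exists n => /=.
- by rewrite -lu limn_einf_lim; exact: is_cvg_einfs.
- by rewrite -ul limn_esup_lim; exact: is_cvg_esups.
Qed.

Section lne_div.
Context {R : realType}.
Implicit Types g t y : R.

(** Exponentiating settles the value [lne 0 = -oo] here, so that later estimates involve real
    numbers only. *)
Lemma lne_div_le g t y : (0 <= g)%R -> (0 < t)%R ->
  (lne g%:E * (t^-1)%:E <= y%:E) = (g <= expR (y * t))%R.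
Proof.
rewrite le_eqVlt => /predU1P[<-|g0] t0.
  by rewrite le0_lneNy// gt0_mulNye ?lte_fin ?invr_gt0// leNye expR_ge0.
rewrite lne_EFin// -EFinM lee_fin ler_pdivrMr//.
by rewrite -{2}[g]lnK ?posrE// ler_expR.
Qed.

Lemma lne_div_ge g t y : (0 <= g)%R -> (0 < t)%R ->
  (y%:E <= lne g%:E * (t^-1)%:E) = (expR (y * t) <= g)%R.
Proof.
rewrite le_eqVlt => /predU1P[<-|g0] t0.
  rewrite le0_lneNy// gt0_mulNye ?lte_fin ?invr_gt0//.
  by rewrite leeNy_eq/= leNgt expR_gt0.
rewrite lne_EFin// -EFinM lee_fin ler_pdivlMr//.
by rewrite -{2}[g]lnK ?posrE// ler_expR.
Qed.

End lne_div.
Local Close Scope ereal_scope.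

Lemma near_ln_ge {R : realType} (A : R) : \forall n \near \oo, A <= ln (n%:R : R).
Proof.
near=> n; have h : expR A <= n%:R by near: n; exact: nbhs_infty_ger.
by rewrite -[A]expRK ler_ln ?posrE ?expR_gt0// (lt_le_trans _ h)// expR_gt0.
Unshelve. all: by end_near. Qed.

(** With [l = ln n], the second term is [exp (K - c n^e)], smaller than any power of [n]. Each term
    takes half of the right side: [A] serves the first, [B] the second, through [x^2 <= 4 exp x] for
    [x >= 0]. *)
Lemma superpoly_absorb {R : realType} (kappa y' y K c e : R) :
  y' < y -> 0 < c -> 0 < e ->
  exists l0 : R, forall l, l0 <= l ->
    4 * expR (kappa + l * y') + expR (K - c * expR (e * l)) <= expR (y * l).
Proof.
move=> yy c0 e0.
have ln8 : expR (ln 8) = 8 :> R by rewrite lnK// posrE.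
have ln2 : expR (ln 2) = 2 :> R by rewrite lnK// posrE.
set A := (`|ln 8| + `|kappa|) / (y - y').
set B := 4 * (`|K| + `|ln 2| + `|y|) / (c * e ^+ 2).
exists (1 + A + B) => l hl.
have A0 : 0 <= A by apply: divr_ge0; [exact: addr_ge0|lra].
have ce : 0 < c * e ^+ 2 by rewrite mulr_gt0// exprn_gt0.
have B0 : 0 <= B.
  by apply: divr_ge0; [rewrite mulr_ge0// !addr_ge0|exact: ltW].
have l1 : 1 <= l by lra.
have hA : `|ln 8| + `|kappa| <= (y - y') * l.
  by rewrite mulrC -ler_pdivrMr ?subr_gt0// -/A; lra.
have hB : 4 * (`|K| + `|ln 2| + `|y|) <= c * e ^+ 2 * l.
  by rewrite [leRHS]mulrC -ler_pdivrMr// -/B; lra.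
have h1 : 8 * expR (kappa + l * y') <= expR (y * l).
  rewrite -[X in X * _]ln8 -expRD ler_expR.
  have := ler_norm (ln 8 : R); have := ler_norm kappa; nra.
have h2 : 2 * expR (K - c * expR (e * l)) <= expR (y * l).
  rewrite -[X in X * _]ln2 -expRD ler_expR.
  have el : (e * l) ^+ 2 <= 4 * expR (e * l).
    have := expR_ge1Dx (e * l / 2).
    have -> : expR (e * l) = expR (e * l / 2) ^+ 2.
      by rewrite -expRM_natl; congr expR; lra.
    have : 0 <= e * l by rewrite mulr_ge0//; lra.
    nra.
  have h3 : c * e ^+ 2 * l * l <= 4 * (c * expR (e * l)).
    have -> : c * e ^+ 2 * l * l = c * (e * l) ^+ 2 by ring.
    by rewrite [leRHS]mulrCA ler_wpM2l// ltW.
  have h4 : 4 * (`|K| + `|ln 2| + `|y|) * l <= c * e ^+ 2 * l * l.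
    by rewrite ler_wpM2r//; lra.
  have := ler_norm (ln 2 : R); have := ler_norm K.
  have := ler_norm (- y); rewrite normrN => ny nK n2.
  have y0 := normr_ge0 y; have K0 := normr_ge0 K.
  have := normr_ge0 (ln 2 : R).
  nra.
lra.
Qed.

(** * Transfer of the two tail bounds to exponents *)

Section tail_asymptotics.
Context {R : realType}.
Variables (p : R) (G : R -> R) (a : nat -> R).
Hypothesis p0 : 0 < p.
Hypothesis G_nonincr : forall s t, s <= t -> G t <= G s.
Hypothesis G0 : forall t, 0 <= G t.
Hypothesis a0 : forall n, 0 <= a n.
Hypothesis lower : exists kappa : R, \forall n \near \oo,
  n%:R * G (kappa + p^-1 * ln n%:R) <= 4 * a n.
Hypothesis upper : forall gamma : R, 0 < gamma < p^-1 ->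
  exists K c e : R, [/\ 0 < c, 0 < e & \forall n \near \oo,
  a n <= 4 * (n%:R * G (gamma * ln n%:R)) + expR (K - c * expR (e * ln n%:R))].

Let u t := (lne (G t)%:E * (t^-1)%:E)%E.
Let v n := (lne (a n)%:E * ((ln n%:R)^-1)%:E)%E.

(** The exponent obtained is [1 + z gamma], which tends to [1 + z / p < y] as [gamma] tends to
    [1 / p]. The slack [kappa] allows for rounding [t] to some [gamma * ln n]. *)
Lemma upper_step (y z kappa : R) : p * y - p > z ->
  exists gamma, 0 < gamma < p^-1 /\ \forall n \near \oo,
    G (gamma * ln n%:R) <= expR (kappa + z * (gamma * ln n%:R)) ->
    (v n <= y%:E)%E.
Proof.
move=> zy; have pV0 : 0 < p^-1 by rewrite invr_gt0.
have pp : p * p^-1 = 1 by rewrite mulfV// gt_eqF.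
pose eta := y - 1 - z * p^-1.
have eta0 : 0 < eta.
  have : z * p^-1 < y - 1 by rewrite ltr_pdivrMr//; lra.
  by rewrite /eta; lra.
(* The first bound keeps [gamma] positive, the second makes [|z| eps] less than the available margin
   [eta]. *)
pose eps := Num.min (p^-1 / 2) (eta / (2 * (`|z| + 1))).
have z1 : 0 < 2 * (`|z| + 1) by have := normr_ge0 z; lra.
have eps0 : 0 < eps by rewrite /eps lt_min !divr_gt0.
have eps1 : eps <= p^-1 / 2 by rewrite /eps ge_min lexx.
have eps2 : eps * (2 * (`|z| + 1)) <= eta.
  by rewrite -ler_pdivlMr// /eps ge_min lexx orbT.
exists (p^-1 - eps); have gam : 0 < p^-1 - eps < p^-1 by lra.
split => //; set gamma := p^-1 - eps in gam *.
have hy : 1 + z * gamma < y.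
  rewrite /gamma; have := ler_norm (- z); rewrite normrN /eta in eps2 *; nra.
have [K [c [e [c0 e0 hU]]]] := upper _ gam.
have [l0 hl0] := superpoly_absorb kappa _ _ K c e hy c0 e0.
near=> n => hG.
have l0n : l0 <= ln n%:R by near: n; exact: near_ln_ge.
have l1n : 1 <= ln (n%:R : R) by near: n; exact: near_ln_ge.
have n0 : 0 < n%:R :> R by near: n; exact: nbhs_infty_gtr.
rewrite /v lne_div_le//; last by lra.
apply: le_trans (hl0 _ l0n).
have : a n <= 4 * (n%:R * G (gamma * ln n%:R)) + expR (K - c * expR (e * ln n%:R)).
  by near: n.
move=> /le_trans; apply; rewrite lerD2r ler_wpM2l//.
apply: le_trans (ler_wpM2l (ltW n0) hG) _.
rewrite -{1}[n%:R]lnK ?posrE// -expRD ler_expR; lra.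
Unshelve. all: by end_near. Qed.

Lemma lower_step (y z kappa kappa' : R) :
  (\forall n \near \oo, n%:R * G (kappa' + p^-1 * ln n%:R) <= 4 * a n) ->
  p * y - p < z ->
  \forall n \near \oo,
    expR (z * (p^-1 * ln n%:R) - kappa) <= G (kappa' + p^-1 * ln n%:R) ->
    (y%:E <= v n)%E.
Proof.
move=> hL zy; have pV0 : 0 < p^-1 by rewrite invr_gt0.
pose eta := 1 + z * p^-1 - y; have eta0 : 0 < eta.
  have : y - 1 < z * p^-1 by rewrite ltr_pdivlMr//; lra.
  by rewrite /eta; lra.
have ln4 : expR (ln 4) = 4 :> R by rewrite lnK// posrE.
near=> n => hG.
have l1n : 1 <= ln (n%:R : R) by near: n; exact: near_ln_ge.
have l2n : (ln 4 + kappa) / eta <= ln n%:R by near: n; exact: near_ln_ge.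
have n0 : 0 < n%:R :> R by near: n; exact: nbhs_infty_gtr.
rewrite /v lne_div_ge//; last by lra.
rewrite -(@ler_pM2l _ 4)//.
have : n%:R * G (kappa' + p^-1 * ln n%:R) <= 4 * a n by near: n.
apply: le_trans; apply: le_trans (ler_wpM2l (ltW n0) hG).
rewrite -[X in X * _]ln4 -[X in _ <= X * _]lnK ?posrE// -!expRD ler_expR.
move: l2n; rewrite ler_pdivrMr// /eta; lra.
Unshelve. all: by end_near. Qed.

Lemma tail_limn_esup_le (y : R) :
  (limf_esup u (+oo%R : set_system R) < (p * y - p)%:E)%E ->
  \forall n \near \oo, (v n <= y%:E)%E.
Proof.
move=> /lte_real_between[z [uz]]; rewrite lte_fin => zy.
have [gamma [gam hn]] := upper_step _ _ 0 zy.
have [M [_ hM]] := limf_esup_lt_near _ _ _ _ uz.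
near=> n; have : G (gamma * ln n%:R) <= expR (0 + z * (gamma * ln n%:R)); last by near: n.
have gl : `|M| + 1 < gamma * ln n%:R.
  rewrite mulrC -ltr_pdivrMr; last by lra.
  by apply: (@lt_le_trans _ _ ((`|M| + 1) / gamma + 1));
    [lra|near: n; exact: near_ln_ge].
rewrite add0r -lne_div_le//; last by have := normr_ge0 M; lra.
by apply/ltW/hM; have := ler_norm M; lra.
Unshelve. all: by end_near. Qed.

Lemma tail_limn_einf_ge (y : R) :
  ((p * y - p)%:E < limf_einf u (+oo%R : set_system R))%E ->
  \forall n \near \oo, (y%:E <= v n)%E.
Proof.
move=> /lte_real_between[z []]; rewrite lte_fin => zy zu.
have pV0 : 0 < p^-1 by rewrite invr_gt0.
have [kappa' hL] := lower.
have hn := lower_step y z (- (z * kappa')) kappa' hL zy.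
have [M [_ hM]] := limf_einf_gt_near _ _ _ _ zu.
near=> n.
suff : expR (z * (p^-1 * ln n%:R) - - (z * kappa')) <= G (kappa' + p^-1 * ln n%:R).
  by near: n.
have gl : `|M| + 1 < kappa' + p^-1 * ln n%:R.
  rewrite -ltrBlDl mulrC -ltr_pdivrMr//.
  by apply: (@lt_le_trans _ _ ((`|M| + 1 - kappa') / p^-1 + 1));
    [rewrite ltrDl|near: n; exact: near_ln_ge].
have -> : z * (p^-1 * ln n%:R) - - (z * kappa') = z * (kappa' + p^-1 * ln n%:R) by ring.
rewrite -lne_div_ge//; last by have := normr_ge0 M; lra.
by apply/ltW/hM; have := ler_norm M; lra.
Unshelve. all: by end_near. Qed.

(** A large [t] with [u t] above [z] is rounded down: [n] is the integer part of
    [expR (p * (t - kappa'))], so [kappa' + p^-1 * ln n] lies within [p^-1 * ln 2] below [t]. There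
    [G] is at least [G t], and the rounding costs a bounded factor. *)
Lemma tail_limn_esup_ge (y : R) N :
  ((p * y - p)%:E < limf_esup u (+oo%R : set_system R))%E ->
  exists2 n, (N <= n)%N & (y%:E <= v n)%E.
Proof.
move=> /lte_real_between[z []]; rewrite lte_fin => zy zu.
have pV0 : 0 < p^-1 by rewrite invr_gt0.
have [kappa' hL] := lower.
have [N1 _ hn] := lower_step y z (`|z| * (p^-1 * ln 2) - z * kappa') kappa' hL zy.
have hV : \forall t \near +oo, kappa' + p^-1 * ln (N + N1).+1%:R < t /\ 0 < t.
  near=> t; split; near: t; apply: nbhs_pinfty_gt; exact: num_real.
have [t [tN t0] zt] := limf_esup_gt_ex _ _ _ _ zu hV.
pose x := expR (p * (t - kappa')).
have xN : (N + N1).+1%:R <= x.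
  rewrite -[leLHS]lnK ?posrE// ler_expR -ler_pdivrMl//; lra.
have x1 : 1 <= x by apply: le_trans xN; rewrite ler1n.
have /andP[nx xn] : (Num.truncn x)%:R <= x < (Num.truncn x).+1%:R.
  by apply: truncn_itv; lra.
have nN : (N + N1 < Num.truncn x)%N by rewrite truncn_gt_nat.
set n := Num.truncn x in nx xn nN.
have n_gt0 : (0 < n)%N by exact: leq_ltn_trans nN.
have Nn : (N <= n)%N by rewrite (leq_trans (leq_addr N1 N))// ltnW.
have N1n : (N1 <= n)%N by rewrite (leq_trans (leq_addl N N1))// ltnW.
exists n => //; apply: hn => //=.
have n0 : 0 < n%:R :> R by rewrite ltr0n.
have lx : ln x = p * (t - kappa') by rewrite expRK.
have h1 : ln n%:R <= p * (t - kappa').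
  by rewrite -lx ler_ln ?posrE ?expR_gt0.
have h2 : p * (t - kappa') <= ln 2 + ln n%:R.
  rewrite -lx -lnM ?posrE// ler_ln ?posrE ?mulr_gt0 ?expR_gt0//.
  have n1 : 1 <= n%:R :> R by rewrite ler1n.
  by move: xn; rewrite -natr1; lra.
have {}h1 : p^-1 * ln n%:R <= t - kappa' by rewrite ler_pdivrMl.
have {}h2 : t - kappa' <= p^-1 * ln 2 + p^-1 * ln n%:R.
  by rewrite -mulrDr ler_pdivlMl.
apply: (@le_trans _ _ (G t)); last by apply: G_nonincr; lra.
apply: (@le_trans _ _ (expR (z * t))).
  rewrite ler_expR; set w := p^-1 * ln n%:R in h1 h2 *; set w2 := p^-1 * ln 2 in h2 *.
  have := ler_norm (- z); rewrite normrN; have := ler_norm z.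
  have w20 : 0 <= w2 by lra.
  nra.
by rewrite -lne_div_ge// ltW.
Unshelve. all: by end_near. Qed.

Lemma tail_limn_einf_le (y : R) N :
  (limf_einf u (+oo%R : set_system R) < (p * y - p)%:E)%E ->
  exists2 n, (N <= n)%N & (v n <= y%:E)%E.
Proof.
move=> /lte_real_between[z [uz]]; rewrite lte_fin => zy.
pose kap := `|z| * (p^-1 * ln 2).
have [gamma [/andP[g0 gp] [N1 _ hn]]] := upper_step y z kap zy.
have hV : \forall t \near +oo, gamma * ln (N + N1).+1%:R < t /\ 0 < t.
  near=> t; split; near: t; apply: nbhs_pinfty_gt; exact: num_real.
have [t [tN t0] zt] := limf_einf_lt_ex _ _ _ _ uz hV.
pose x := expR (gamma^-1 * t).
have xN : (N + N1).+1%:R <= x.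
  by rewrite -[leLHS]lnK ?posrE// ler_expR ler_pdivlMl// ltW.
have x1 : 1 <= x by apply: le_trans xN; rewrite ler1n.
have /andP[nx xn] : (Num.truncn x)%:R <= x < (Num.truncn x).+1%:R.
  by apply: truncn_itv; lra.
have nN : (N + N1 < Num.truncn x)%N by rewrite truncn_gt_nat.
set n := Num.truncn x in nx xn nN.
have n_gt0 : (0 < n)%N by exact: leq_ltn_trans nN.
have Nn : (N <= n)%N by rewrite (leq_trans (leq_addr N1 N))// ltnW.
have N1n : (N1 <= n)%N by rewrite (leq_trans (leq_addl N N1))// ltnW.
(* An upper bound on [G] passes to larger arguments, so here [t] is rounded up and [n.+1] replaces
   [n]. *)
exists n.+1; first exact: leqW.
apply: hn => /=; first exact: leqW.
have n0 : 0 < n%:R :> R by rewrite ltr0n.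
have lx : ln x = gamma^-1 * t by rewrite expRK.
have h1 : gamma^-1 * t <= ln n.+1%:R.
  by rewrite -lx ler_ln ?posrE ?expR_gt0// ltW.
have h2 : ln n.+1%:R <= ln 2 + gamma^-1 * t.
  rewrite -lx -lnM ?posrE ?expR_gt0// ler_ln ?posrE ?mulr_gt0 ?expR_gt0//.
  by rewrite -natr1; lra.
have {}h1 : t <= gamma * ln n.+1%:R by rewrite -ler_pdivrMl.
have {}h2 : gamma * ln n.+1%:R <= gamma * ln 2 + t.
  by rewrite -ler_pdivlMl// mulrDr mulKf// gt_eqF.
apply: (@le_trans _ _ (G t)); first exact: G_nonincr.
apply: (@le_trans _ _ (expR (z * t))); last first.
  have ln20 : 0 <= ln 2 :> R by rewrite ln_ge0// ler1n.
  have h3 : gamma * ln 2 <= p^-1 * ln 2 by rewrite ler_wpM2r// ltW.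
  rewrite ler_expR /kap; set w := gamma * ln n.+1%:R in h1 h2 *.
  set w2 := gamma * ln 2 in h2 h3; set w3 := p^-1 * ln 2 in h3 *.
  have := ler_norm (- z); rewrite normrN; have := ler_norm z.
  have w20 : 0 <= w3 by lra.
  nra.
by rewrite -lne_div_le// ltW.
Unshelve. all: by end_near. Qed.

(** This is the increasing map [(L + p) / p], in the shape it takes for [beta = - L]. *)
Let Phi (L : \bar R) : \bar R := ((- (- L - p%:E)) * (p^-1)%:E)%E.

Let PhiE : (forall L y, (y%:E < Phi L)%E = ((p * y - p)%:E < L)%E) *
  (forall L y, (Phi L < y%:E)%E = (L < (p * y - p)%:E)%E).
Proof.
have pV0 : 0 < p^-1 by rewrite invr_gt0.
split; case=> [l| |] y; rewrite /Phi/=.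
- rewrite -EFinM !lte_fin ltr_pdivlMr//.
  by apply/idP/idP; lra.
- by rewrite gt0_mulye ?lte_fin// !ltry.
- by rewrite gt0_mulNye ?lte_fin// !ltNge !leNye.
- rewrite -EFinM !lte_fin ltr_pdivrMr//.
  by apply/idP/idP; lra.
- by rewrite gt0_mulye ?lte_fin// !ltNge !leey.
- by rewrite gt0_mulNye ?lte_fin// !ltNyr.
Qed.

Lemma tail_limn_esup : limn_esup v =
  ((- (- limf_esup u (+oo%R : set_system R) - p%:E)) * (p^-1)%:E)%E.
Proof.
rewrite -/(Phi _); apply/eqP; rewrite eq_le; apply/andP; split.
  by apply: limf_esup_le => y; rewrite PhiE => /tail_limn_esup_le.
apply: limf_esup_ge => y; rewrite PhiE => hy V [N _ NV].
by have [n Nn vn] := tail_limn_esup_ge _ N hy; exists n => //; exact: NV.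
Qed.

Lemma tail_limn_einf : limn_einf v =
  ((- (- limf_einf u (+oo%R : set_system R) - p%:E)) * (p^-1)%:E)%E.
Proof.
rewrite -/(Phi _) -/(limf_einf v \oo); apply/eqP; rewrite eq_le; apply/andP; split.
  apply: limf_einf_le => y; rewrite PhiE => hy V [N _ NV].
  by have [n Nn vn] := tail_limn_einf_le _ N hy; exists n => //; exact: NV.
by apply: limf_einf_ge => y; rewrite PhiE => /tail_limn_einf_ge.
Qed.

End tail_asymptotics.

Lemma lim_exponent_inj {R : realType} (p : R) (b c : \bar R) : 0 < p ->
  ((- (b - p%:E)) * (p^-1)%:E = (- (c - p%:E)) * (p^-1)%:E)%E -> b = c.
Proof.
move=> p0; have pV0 : 0 < p^-1 by rewrite invr_gt0.
case: b => [b| |]; case: c => [c| |]//=;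
  rewrite -?EFinB -?EFinN -?EFinM ?gt0_mulye ?gt0_mulNye ?lte_fin// => -[].
by move=> /(mulIf (lt0r_neq0 pV0)) h; congr EFin; lra.
Qed.

(** * Tail bounds under the weak law *)

Lemma iidPr1_norm {R : realType} {K : finType} {B : normedModType R} (q : K -> R)
    (b : K -> B) (t : R) :
  iidPr q 1 (fun l => t < `|\sum_(k <- l) b k|) = \sum_k q k * (t < `|b k|)%R%:R.
Proof. by apply: eq_bigr => k _ /=; rewrite big_seq1. Qed.

Section weak_law_tails.
Context {R : realType} {B : normedModType R} (a : nat -> R -> R).
Hypothesis a_ge0 : forall n t, 0 <= a n t.
Hypothesis a_le1 : forall n t, a n t <= 1.
Hypothesis a_nonincr : forall n s t, s <= t -> a n t <= a n s.
Hypothesis a_iid : forall n (delta eta : R), 0 < delta -> 0 < eta ->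
  exists N (q : 'I_N.+1 -> R) (b : 'I_N.+1 -> B),
    [/\ forall k, 0 <= q k, \sum_k q k = 1 & forall m t, (m <= n)%N ->
      a m (t + delta) - eta <= iidPr q m (fun l => t < `|\sum_(k <- l) b k|) /\
      iidPr q m (fun l => t < `|\sum_(k <- l) b k|) <= a m (t - delta) + eta].

Lemma min1_tail_le_sum_tail n (t : R) : 0 < t -> a n t < 4^-1 ->
  Num.min 1 (n.+1%:R * a 1 (3 * t)) <= 4 * a n.+1 t.
Proof.
move=> t0 an; set A := Num.min _ _; apply/ler_addgt0Pr => eps eps0.
have n0 := ler0n R n.+1.
pose eta := Num.min (eps / (n.+1%:R + 5)) (4^-1 - a n t).
have n50 : 0 < n.+1%:R + 5 :> R by lra.
have eta0 : 0 < eta by rewrite /eta lt_min divr_gt0//; lra.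
have eta1 : eta * (n.+1%:R + 5) <= eps by rewrite -ler_pdivlMr// /eta ge_min lexx.
have eta2 : eta <= 4^-1 - a n t by rewrite /eta ge_min lexx orbT.
have d0 : 0 < t / 4 by lra.
have [N [q [b [q0 q1 hq]]]] := a_iid n.+1 (t / 4) eta d0 eta0.
(* The discretization shifts thresholds by [t / 4]: [U - t / 4 = t] for the sums, and
   [2 * U + t / 4 <= 3 * t] for one summand, hence 3 in place of 2. *)
pose U := t + t / 4.
have [_ h1] := hq n U (leqnSn n).
have [_ h2] := hq n.+1 U (leqnn _).
have [h3 _] := hq 1%N (2 * U) isT.
have m1 : a n (U - t / 4) <= a n t by apply: a_nonincr; rewrite /U; lra.
have m2 : a n.+1 (U - t / 4) <= a n.+1 t by apply: a_nonincr; rewrite /U; lra.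
have m3 : a 1%N (3 * t) <= a 1%N (2 * U + t / 4) by apply: a_nonincr; rewrite /U; lra.
have h1' : iidPr q n (fun l => U < `|\sum_(k <- l) b k|) <= 4^-1 by lra.
have := one_big_summand q q0 q1 b n U h1'.
rewrite iidPr1_norm in h3; set s := \sum_k _ in h3 * => hs.
have A1 : A <= 1 by rewrite /A ge_min lexx.
have A2 : A <= n.+1%:R * s + n.+1%:R * eta.
  apply: (@le_trans _ _ (n.+1%:R * a 1%N (3 * t))); first by rewrite /A ge_min lexx orbT.
  by rewrite -mulrDr ler_wpM2l//; lra.
have A3 : A <= Num.min 1 (n.+1%:R * s) + n.+1%:R * eta.
  have : 0 <= n.+1%:R * eta by rewrite mulr_ge0// ltW.
  by rewrite /Num.min; case: ifP => _; lra.
nra.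
Qed.

Variable p : R.
Hypothesis p02 : 0 < p < 2.
Hypothesis weak_law : forall s eps : R, 0 < s -> 0 < eps ->
  \forall n \near \oo, a n (s * expR (p^-1 * ln n%:R)) < eps.

(** By the weak law [4 * a n t < 1] eventually, so the minimum with 1 in the one-summand bound
    cannot be 1. *)
Lemma tail_le_sum_tail (s : R) : 0 < s -> \forall n \near \oo,
  n%:R * a 1 (3 * (s * expR (p^-1 * ln n%:R))) <= 4 * a n (s * expR (p^-1 * ln n%:R)).
Proof.
move=> s0; have p0 : 0 < p by case/andP: p02.
have q4 : 0 < 4^-1 :> R by [].
have [N _ hN] := weak_law s _ s0 q4.
exists N.+2 => // -[//|n] /= Nn.
have Nn' : (N <= n)%N := ltnW Nn.
have n0 : (0 < n)%N by rewrite -ltnS (leq_ltn_trans _ Nn).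
set t := s * expR _; have t0 : 0 < t by rewrite mulr_gt0 ?expR_gt0.
have hn1 : a n.+1 t < 4^-1 by apply: hN; exact: leqW.
have hn : a n t < 4^-1.
  apply: le_lt_trans (hN n Nn'); apply: a_nonincr.
  rewrite /t ler_wpM2l ?(ltW s0)// ler_expR ler_wpM2l ?invr_ge0 ?(ltW p0)//.
  by rewrite ler_ln ?posrE ?ltr0n// ler_nat.
have := min1_tail_le_sum_tail n t t0 hn.
by rewrite ge_min => /orP[|//]; lra.
Qed.

(** Rounding [(u / 3)^p] down to an integer [n] costs a factor 2, and [n * a 1 u <= 1] there. For
    small [u] the probability is simply at most 1. *)
Lemma tail_polynomial_bound : exists2 C : R, 0 < C &
  forall u, 0 < u -> a 1 u * expR (p * ln u) <= C.
Proof.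
have p0 : 0 < p by case/andP: p02.
have q4 : 0 < 4^-1 :> R by [].
have [N1 _ h1] := tail_le_sum_tail 1 ltr01.
have [N2 _ h2] := weak_law 1 _ ltr01 q4.
pose N := (N1 + N2).+1.
have hN n : (N <= n)%N -> n%:R * a 1%N (3 * expR (p^-1 * ln n%:R)) <= 1.
  move=> Nn; have N1n : (N1 <= n)%N by rewrite (leq_trans _ Nn)// leqW// leq_addr.
  have N2n : (N2 <= n)%N by rewrite (leq_trans _ Nn)// leqW// leq_addl.
  have := h1 n N1n; have := h2 n N2n; rewrite /= mul1r; lra.
have N0 : 0 < N%:R :> R by rewrite ltr0n.
exists (2 * N%:R * expR (p * ln 3)).
  by rewrite !mulr_gt0 ?expR_gt0.
move=> u u0; pose y := expR (p * ln (u / 3)).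
have u30 : 0 < u / 3 by lra.
have y0 : 0 < y by exact: expR_gt0.
have -> : expR (p * ln u) = y * expR (p * ln 3).
  rewrite /y -expRD -mulrDr -lnM ?posrE//; congr (expR (p * ln _)); lra.
rewrite mulrA ler_wpM2r ?expR_ge0//.
have [Ny|yN] := leP N%:R y; last first.
  by have := a_le1 1 u; have := a_ge0 1 u; nra.
have N1' : 1 <= N%:R :> R by rewrite ler1n.
have /andP[ny yn] : (Num.truncn y)%:R <= y < (Num.truncn y).+1%:R.
  by apply: truncn_itv; lra.
have Nn : (N <= Num.truncn y)%N by rewrite truncn_ge_nat// ltW.
set n := Num.truncn y in ny yn Nn.
have n1 : 1 <= n%:R :> R by rewrite ler1n; exact: leq_trans Nn.
have : 3 * expR (p^-1 * ln n%:R) <= u.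
  suff : expR (p^-1 * ln n%:R) <= u / 3 by lra.
  rewrite -[leRHS]lnK ?posrE// ler_expR ler_pdivrMl// -[leRHS]expRK ler_ln ?posrE ?expR_gt0//.
  by lra.
move=> /a_nonincr-/(_ 1%N) h; have := hN _ Nn.
have := a_ge0 1 u; move: yn; rewrite -natr1 => yn au hn.
have au1 : n%:R * a 1%N u <= 1 by apply: le_trans hn; rewrite ler_wpM2l//; lra.
have : a 1%N u * y <= a 1%N u * (2 * n%:R) by rewrite ler_wpM2l//; lra.
nra.
Qed.

Lemma sum_tail_truncation : exists2 K : R, 0 <= K & forall n (L r lambda : R),
  1 <= L -> 0 < r -> 0 <= lambda -> lambda * (4 * L) <= 2^-1 ->
  let kappa := expR (n%:R * (2 * lambda ^+ 2 * (K * expR ((2 - p) * ln (4 * L)))) -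
    lambda * r) in
  kappa + (n%:R * a 1 L + a n (r / 2)) < 1 ->
  a n (4 * r) <= n%:R * a 1 L + kappa.
Proof.
have [p0 p2] := andP p02; have [C C0 hC] := tail_polynomial_bound.
have ln2 : expR (ln 2) = 2 :> R by rewrite lnK// posrE.
have ln2_gt0 : 0 < ln 2 :> R by rewrite ln_gt0// ltr1n.
pose P2 := expR (p * ln 2); pose w := expR ((2 - p) * ln 2).
have P2w : P2 * w = 4.
  rewrite /P2 /w -expRD -mulrDl.
  have -> : (p + (2 - p)) * ln 2 = ln 2 + ln 2 :> R by ring.
  by rewrite expRD ln2; lra.
have w1 : 1 < w by rewrite /w -[X in X < _]expR0 ltr_expR mulr_gt0//; lra.
have P20 : 0 < P2 by exact: expR_gt0.
pose C' := C * P2 + 1; have C'0 : 0 <= C' by rewrite /C'; nra.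
pose K := 1 + 4 * C' / (w - 1).
have K0 : 0 <= K by rewrite /K addr_ge0// divr_ge0 ?mulr_ge0//; lra.
exists K => // n L r lambda L1 r0 l0 lL; set V := K * _; move=> kappa hlt.
apply/ler_addgt0Pr => eps eps0.
have L0 : 0 < 4 * L by lra.
(* The truncation level is a power of two for the dyadic moment bound; being at least [2 * L], it
   stays above [L] after a shift by [delta <= 1/2]. *)
have [J J2 J4] : exists2 J, 2 * L <= 2 ^+ J & 2 ^+ J <= 4 * L.
  have /andP[kL Lk] : (Num.truncn (2 * L))%:R <= 2 * L < (Num.truncn (2 * L)).+1%:R.
    by apply: truncn_itv; lra.
  have k0 : (0 < Num.truncn (2 * L))%N by rewrite truncn_gt0; lra.
  have /andP[h1 h2] := trunc_log_bounds (isT : (1 < 2)%N) k0.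
  exists (trunc_log 2 (Num.truncn (2 * L))).+1.
    by rewrite -natrX; apply: le_trans (ltW Lk) _; rewrite ler_nat.
  rewrite exprS -natrX; apply: (@le_trans _ _ (2 * (Num.truncn (2 * L))%:R)); last by lra.
  by rewrite ler_wpM2l// ler_nat.
have n20 : 0 < n%:R + 2 :> R by have := ler0n R n; lra.
pose gap := 1 - (kappa + (n%:R * a 1%N L + a n (r / 2))).
have gap0 : 0 < gap by rewrite /gap; lra.
(* The three bounds make the final error at most [eps], keep the strict inequality [< 1] after
   discretization, and hold [eta] below [(4 L)^(-p)], so that at all dyadic levels used it only adds
   1 to [C']. *)
pose eta := Num.min (Num.min (eps / (n%:R + 2)) (gap / (n%:R + 2)))
  (expR (- (p * ln (4 * L)))).
have eta0 : 0 < eta by rewrite /eta !lt_min !divr_gt0//= expR_gt0.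
have eta1 : eta * (n%:R + 2) <= eps by rewrite -ler_pdivlMr// /eta !ge_min lexx.
have eta2 : eta * (n%:R + 2) <= gap by rewrite -ler_pdivlMr// /eta !ge_min lexx orbT.
have eta3 : eta * expR (p * ln (4 * L)) <= 1.
  rewrite -ler_pdivlMr ?expR_gt0// mul1r -expRN /eta ge_min lexx orbT//.
pose delta := Num.min 2^-1 (r / 2).
have delta0 : 0 < delta by rewrite /delta lt_min; apply/andP; split; lra.
have delta1 : delta <= 2^-1 by rewrite /delta ge_min lexx.
have delta2 : delta <= r / 2 by rewrite /delta ge_min lexx orbT.
have [N [q [b [q0 q1 hq]]]] := a_iid n.+1 delta eta delta0 eta0.
have tail_q (u v : R) : v <= u - delta -> \sum_k q k * (u < `|b k|)%R%:R <= a 1%N v + eta.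
  move=> uv; have [_] := hq 1%N u isT; rewrite iidPr1_norm.
  by have := a_nonincr 1 _ _ uv; lra.
have dyadic i : (i <= J)%N ->
    (\sum_k q k * (2 ^+ i < `|b k|)%R%:R) * 4 ^+ i <= C' * w ^+ i.
  move=> iJ; rewrite -P2w exprMn mulrA ler_wpM2r ?exprn_ge0 ?expR_ge0//.
  have i1 : 1 <= 2 ^+ i :> R by rewrite exprn_ege1// ler1n.
  have hi : 2 ^+ i / 2 <= 2 ^+ i - delta by lra.
  apply: le_trans (ler_wpM2r (exprn_ge0 _ (ltW P20)) (tail_q _ _ hi)) _.
  have i20 : 0 < 2 ^+ i / 2 :> R by lra.
  have PE : P2 ^+ i = expR (p * ln (2 ^+ i)).
    by rewrite /P2 -expRM_natl lnXn// mulrCA mulr_natl.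
  have PE2 : P2 ^+ i = expR (p * ln (2 ^+ i / 2)) * P2.
    by rewrite PE /P2 -expRD -mulrDr -lnM ?posrE// divfK.
  rewrite mulrDl /C' lerD//.
    by rewrite PE2 mulrA ler_wpM2r ?(ltW P20)// hC.
  apply: le_trans eta3; rewrite ler_wpM2l ?(ltW eta0)// PE ler_expR ler_wpM2l ?(ltW p0)//.
  have h2i : 0 < 2 ^+ i :> R by lra.
  rewrite ler_ln ?posrE//.
  by apply: le_trans J4; rewrite ler_weXn2l// ler1n.
have hV : \sum_k q k * ((`|b k| <= 2 ^+ J)%R%:R * `|b k| ^+ 2) <= V.
  apply: le_trans (truncated_moment_dyadic q q0 q1 b C' w J C'0 w1 dyadic) _.
  rewrite -/K ler_wpM2l// /w -expRM_natl ler_expR mulrCA ler_wpM2l//; first by lra.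
  by rewrite [J%:R * _]mulr_natl -lnXn// ler_ln ?posrE ?exprn_gt0.
have M0 : 0 <= 2 ^+ J :> R by rewrite exprn_ge0.
have lM : lambda * 2 ^+ J <= 2^-1 by apply: le_trans lL; rewrite ler_wpM2l.
have := iidPr_norm_truncated q q0 q1 b (2 ^+ J) V lambda r n M0 hV l0 lM.
rewrite /= -/kappa; set big := n%:R * \sum_k _.
have hbig : big <= n%:R * a 1%N L + n%:R * eta.
  by rewrite -mulrDr ler_wpM2l// tail_q//; lra.
have [_ hr] := hq n r (leqnSn n).
have hr2 : a n (r - delta) <= a n (r / 2) by apply: a_nonincr; lra.
have [h3r _] := hq n (3 * r) (leqnSn n).
have h4r : a n (4 * r) <= a n (3 * r + delta) by apply: a_nonincr; lra.
move=> hfin.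
have : kappa + (big + iidPr q n (fun l => r < `|\sum_(k <- l) b k|)) < 1.
  by move: eta2; rewrite /gap; lra.
by move=> /hfin; lra.
Qed.

Lemma sum_tail_upper_bound (s gamma : R) : 0 < s -> 0 < gamma < p^-1 ->
  exists K c e : R, [/\ 0 < c, 0 < e & \forall n \near \oo,
  a n (s * expR (p^-1 * ln n%:R)) <=
  4 * (n%:R * a 1 (expR (gamma * ln n%:R))) + expR (K - c * expR (e * ln n%:R))].
Proof.
move=> s0 /andP[g0 gp]; have [p0 p2] := andP p02.
have pp : p * p^-1 = 1 by rewrite mulfV// gt_eqF.
have [K K0 hK] := sum_tail_truncation.
pose eps := p^-1 - gamma; have eps0 : 0 < eps by rewrite /eps; lra.
(* [e] solves [1 + 2 (e - p^-1) + (2 - p) gamma = 0], the exponent of [n] in the variance term;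
   [e < eps] makes [lambda] times the truncation level tend to 0. *)
pose e := eps * (2 - p) / 2; have e0 : 0 < e by rewrite /e; nra.
pose K2 := 2 * K * expR ((2 - p) * ln 4).
have s40 : 0 < s / 4 by lra.
exists K2, (s / 4), e; split => //.
have s80 : 0 < s / 8 by lra.
have q4 : 0 < 4^-1 :> R by [].
have wl := weak_law (s / 8) _ s80 q4.
have ln8 : expR (ln 8) = 8 :> R by rewrite lnK// posrE.
have ln4 : expR (ln 4) = 4 :> R by rewrite lnK// posrE.
have ln4_ge0 : 0 <= ln 4 :> R by rewrite ln_ge0// ler1n.
near=> n.
have n0 : 0 < n%:R :> R by near: n; exact: nbhs_infty_gtr.
have ln0 : 0 <= ln (n%:R : R) by near: n; exact: near_ln_ge.
have hl1 : ln 8 / (eps - e) <= ln (n%:R : R) by near: n; exact: near_ln_ge.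
have hl2 : (K2 + ln 4) / (s / 4 * e) <= ln (n%:R : R) by near: n; exact: near_ln_ge.
have hwl : a n (s / 8 * expR (p^-1 * ln n%:R)) < 4^-1 by near: n.
set l := ln (n%:R : R) in ln0 hl1 hl2 hwl *.
have nE : n%:R = expR l by rewrite lnK ?posrE.
set Q := a 1%N (expR (gamma * l)).
(* If [n Q >= 1/4] the claimed bound is at least 1; this is where the factor 4 comes from. Otherwise
   the three terms required to sum to less than 1 are each at most [1/4]. *)
have [bigQ|smallQ] := leP 4^-1 (n%:R * Q).
  have := a_le1 n (s * expR (p^-1 * l)).
  by have := expR_ge0 (K2 - s / 4 * expR (e * l)); lra.
(* With this [lambda] the variance term [n lambda^2 L^(2-p)] does not depend on
   [n], while [lambda r] grows like [n^e]; [e > 0] is where [p < 2] is used. *)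
pose lambda := expR ((e - p^-1) * l).
have L1 : 1 <= expR (gamma * l).
  by rewrite -expR0 ler_expR mulr_ge0// ltW.
have r0 : 0 < s / 4 * expR (p^-1 * l) by rewrite mulr_gt0 ?expR_gt0.
have ee : 0 < eps - e by rewrite /e; nra.
have lL : lambda * (4 * expR (gamma * l)) <= 2^-1.
  have -> : lambda * (4 * expR (gamma * l)) = 4 * expR (- ((eps - e) * l)).
    by rewrite /lambda mulrCA -expRD; congr (_ * expR _); rewrite /eps; ring.
  have : 8 <= expR ((eps - e) * l).
    by rewrite -[leLHS]ln8 ler_expR mulrC -ler_pdivrMr.
  have := expR_gt0 (- ((eps - e) * l)).
  have : expR (- ((eps - e) * l)) * expR ((eps - e) * l) = 1.
    by rewrite -expRD addNr expR0.
  nra.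
have := hK n (expR (gamma * l)) (s / 4 * expR (p^-1 * l)) lambda L1 r0 (expR_ge0 _) lL.
have -> : 4 * (s / 4 * expR (p^-1 * l)) = s * expR (p^-1 * l) by lra.
have -> : s / 4 * expR (p^-1 * l) / 2 = s / 8 * expR (p^-1 * l) by lra.
have -> : lambda * (s / 4 * expR (p^-1 * l)) = s / 4 * expR (e * l).
  by rewrite /lambda mulrCA -expRD; congr (_ * expR _); ring.
have -> : n%:R * (2 * lambda ^+ 2 * (K * expR ((2 - p) * ln (4 * expR (gamma * l))))) = K2.
  rewrite nE lnM ?posrE ?expR_gt0// expRK mulrDr expRD.
  have h : expR l * lambda ^+ 2 * expR ((2 - p) * (gamma * l)) = 1.
    rewrite /lambda -expRM_natl -!expRD -[RHS]expR0; congr expR.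
    have -> : gamma = p^-1 - eps by rewrite /eps; ring.
    have -> : l + 2 * ((e - p^-1) * l) + (2 - p) * ((p^-1 - eps) * l) =
      (2 * e - eps * (2 - p)) * l + (1 - p * p^-1) * l by ring.
    by rewrite pp /e; lra.
  transitivity (K2 * (expR l * lambda ^+ 2 * expR ((2 - p) * (gamma * l)))).
    by rewrite /K2; ring.
  by rewrite h mulr1.
rewrite -/Q /= => hfin.
have kap : expR (K2 - s / 4 * expR (e * l)) <= 4^-1.
  rewrite [leRHS](_ : _ = expR (- ln 4)) ?ler_expR; last by rewrite expRN ln4.
  have : K2 + ln 4 <= s / 4 * e * l by rewrite mulrC -ler_pdivrMr// mulr_gt0.
  have : s / 4 * (e * l) <= s / 4 * expR (e * l).
    by rewrite ler_wpM2l ?ltW//; have := expR_ge1Dx (e * l); lra.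
  by lra.
have Q0 : 0 <= n%:R * Q by rewrite mulr_ge0// a_ge0.
have : expR (K2 - s / 4 * expR (e * l)) +
  (n%:R * Q + a n (s / 8 * expR (p^-1 * l))) < 1 by lra.
by move=> /hfin; lra.
Unshelve. all: by end_near. Qed.

End weak_law_tails.

(** * Identification of the exponents with beta-bar and beta-underline *)

Lemma lte_fin_lne {R : realType} (t y : R) : 0 <= y ->
  (t%:E < lne y%:E)%E = (expR t < y).
Proof.
rewrite le_eqVlt => /predU1P[<-|y0].
  by rewrite le0_lneNy// !ltNge leNye expR_ge0.
by rewrite lne_EFin// lte_fin -{2}[y]lnK ?posrE// ltr_expR.
Qed.

Theorem theorem2p1 (R : realType) (d : measure_display) (T : measurableType d)
  (P : probability T R) (B : completeNormedModType R)
  (X : T -> B) (Xs : nat -> T -> B) (p : R) :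
  0 < p < 2 ->
  separable_space B ->
  borel_rv X -> (forall n, borel_rv (Xs n)) ->
  mutually_independent P Xs ->
  (forall n, same_distribution P (Xs n) X) ->
  (* S_n / n^{1/p} -> 0 in probability *)
  (forall eps : R, 0 < eps ->
     (fun n : nat => P [set w | eps < `|(n%:R `^ p^-1)^-1 *: partial_sum Xs n w|])
       @ \oo --> 0%E) ->
  forall s : R, 0 < s ->
    [/\ limn_esup (ld_seq P Xs p s) = ((- (beta_bar P X - p%:E)) * (p^-1)%:E)%E,
        limn_einf (ld_seq P Xs p s) = ((- (beta_under P X - p%:E)) * (p^-1)%:E)%E
      & forall bhat : \bar R, (0 <= bhat)%E ->
          (ld_seq P Xs p s @ \oo --> ((- (bhat - p%:E)) * (p^-1)%:E)%E
           <-> (beta_bar P X = bhat /\ beta_under P X = bhat))].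
Proof.
move=> p02 sepB bX0 bX iX sX wl s s0; have [p0 p2] := andP p02.
have [e eP] := separable_dense_seq sepB.
pose a := sum_tail P Xs.
have a0 n t : 0 <= a n t by exact: sum_tail_ge0.
have a1 n t : a n t <= 1 by exact: (sum_tail_le1 P e eP Xs bX).
have anonincr n t u : t <= u -> a n u <= a n t by exact: (le_sum_tail P e eP Xs bX).
have aiid := tail_discretization P e eP X Xs bX0 bX iX sX.
have powE n : (0 < n)%N -> n%:R `^ p^-1 = expR (p^-1 * ln n%:R) :> R.
  by move=> n0; rewrite /powR pnatr_eq0 gtn_eqF.
have awl (r eps : R) : 0 < r -> 0 < eps ->
    \forall n \near \oo, a n (r * expR (p^-1 * ln n%:R)) < eps.
  move=> r0 eps0; have /fine_cvgP[_ /cvgr0Pnorm_lt/(_ _ eps0)[N _ hN]] := wl r r0.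
  exists N.+1 => // n /= Nn; have n0 : (0 < n)%N by exact: leq_ltn_trans Nn.
  have := hN n (ltnW Nn); rewrite /= ger0_norm ?fine_ge0//.
  congr (fine (P _) < _); apply/seteqP; split => w /=;
    rewrite powE// normrZ ger0_norm ?invr_ge0 ?expR_ge0// ltr_pdivlMl ?expR_gt0//;
    by rewrite mulrC.
(* Since [S_1] has the law of [X], this is the tail of [log |X|]. *)
pose G t := a 1%N (expR t).
pose a' n := a n (s * expR (p^-1 * ln n%:R)).
have logE : log_tail P X = (fun t => (lne (G t)%:E * (t^-1)%:E)%E).
  apply/funext => t; rewrite /log_tail; congr (lne _ * _)%E.
  have XE : [set w | (t%:E < lne (`|X w|)%:E)%E] = X @^-1` [set x | expR t < `|x|].
    by apply/seteqP; split => w /=; rewrite lte_fin_lne.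
  have bN : borel_sets [set x : B | expR t < `|x|].
    by apply: sub_sigma_algebra; exact: open_norm_gt.
  rewrite XE -(sX 0%N _ bN) /G /a /sum_tail fine_probK; last first.
    exact: (measurable_sum_tail e eP Xs bX).
  congr (P _); apply/seteqP; split => w /=; by rewrite /partial_sum big_ord1.
(* At [n = 0], where [powE] fails, both sides are [0] because [(ln 0)^-1 = 0]. *)
have ldE : ld_seq P Xs p s = (fun n => (lne (a' n)%:E * ((ln n%:R)^-1)%:E)%E).
  apply/funext => n; rewrite /ld_seq; have [->|n0] := posnP n.
    by rewrite ln0// invr0 !mule0.
  by rewrite powE// /a' /a /sum_tail fine_probK//; exact: (measurable_sum_tail e eP Xs bX).
have Gnonincr t u : t <= u -> G u <= G t by move=> tu; apply: anonincr; rewrite ler_expR.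
have G0 t : 0 <= G t by exact: a0.
have a'0 n : 0 <= a' n by exact: a0.
have lower : exists kappa : R, \forall n \near \oo,
    n%:R * G (kappa + p^-1 * ln n%:R) <= 4 * a' n.
  exists (ln (3 * s)); have := tail_le_sum_tail a anonincr aiid p p02 awl s s0.
  apply: filterS => n; rewrite /G expRD lnK ?posrE ?mulr_gt0//.
  by rewrite mulrA.
have upper gamma : 0 < gamma < p^-1 -> exists K c e' : R,
    [/\ 0 < c, 0 < e' & \forall n \near \oo, a' n <=
    4 * (n%:R * G (gamma * ln n%:R)) + expR (K - c * expR (e' * ln n%:R))].
  exact: (sum_tail_upper_bound a a0 a1 anonincr aiid p p02 awl s gamma s0).
have esupE : limn_esup (ld_seq P Xs p s) = ((- (beta_bar P X - p%:E)) * (p^-1)%:E)%E.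
  rewrite /beta_bar logE ldE.
  exact: (tail_limn_esup p G a' p0 Gnonincr G0 a'0 lower upper).
have einfE : limn_einf (ld_seq P Xs p s) = ((- (beta_under P X - p%:E)) * (p^-1)%:E)%E.
  rewrite /beta_under logE ldE.
  exact: (tail_limn_einf p G a' p0 Gnonincr G0 a'0 lower upper).
split => // bhat _; split => [ld_cvg|[bb bu]].
  have [ui us] := cvg_limn_einf_sup ld_cvg.
  by split; apply: (lim_exponent_inj p _ _ p0); [rewrite -esupE|rewrite -einfE].
by apply: cvg_limn_esup_einf; rewrite ?esupE ?einfE ?bb ?bu.
Qed.
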